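(* Let $1\le p<\infty$. Let $F:\mathbb{T}\to\mathbb{C}$ be such that $t\mapsto F(e^{it})$ is absolutely continuous on $[0,2\pi]$ (with $F(e^{i0})=F(e^{i2\pi})$), and suppose $\dot F\in L^p(0,2\pi)$, where $\dot F(e^{it})=\frac{d}{dt}F(e^{it})$ (defined a.e.). Let $w=P[F]$ be the Poisson integral of $F$. Then, writing $z=re^{i\theta}\in\mathbb{D}$ and $w_r=\partial w/\partial r$, $$\|w_r\|_{L^p}\le \big(2C(p)\big)^{1/p}\,\|\dot F\|_{L^p},$$ where $$C(p)=\int_0^1 \left(\frac{4\tanh^{-1}r}{\pi r}\right)^p r\,dr<\infty .$$ In particular $w_r\in L^p(\mathbb{D})$.
   Context: $\mathbb{D}$ is the open unit disk and $\mathbb{T}$ the unit circle. For $F\in L^1(\mathbb{T})$, the Poisson integral is $P[F](re^{i\theta})=\int_0^{2\pi}P_r(t-\theta)F(e^{it})\,dt$ with $P_r(t-\theta)=\frac{1}{2\pi}\frac{1-r^2}{1-2r\cos(t-\theta)+r^2}$. For $G$ on $[0,2\pi]$, $\|G\|_{L^p}=\left(\frac{1}{2\pi}\int_0^{2\pi}|G(e^{it})|^p\,dt\right)^{1/p}$ for $1\le p<\infty$. For a function $f$ on $\mathbb{D}$, the Bergman norm is $\|f\|_{L^p}=\left(\int_{\mathbb{D}}|f|^p\,dA\right)^{1/p}$, where $dA=\frac{1}{\pi}dx\,dy=\frac1\pi r\,dr\,d\theta$ is normalized area measure; $L^p(\mathbb{D})$ is the space of functions with finite such norm. $\tanh^{-1}r=\frac12\log\frac{1+r}{1-r}$.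 *)

(* Defs.v *)
From HB Require Import structures.
From mathcomp Require Import all_boot all_order all_algebra.
From mathcomp Require Import all_classical all_reals all_analysis.
Set Implicit Arguments. Unset Strict Implicit. Unset Printing Implicit Defensive.
Import Order.TTheory GRing.Theory Num.Theory.
Import numFieldNormedType.Exports.
Local Open Scope classical_set_scope.
Local Open Scope ring_scope.

(* A complex-valued function on the circle, t |-> F(e^{it}), is represented by
   its real part [u] and imaginary part [v]:  F(e^{it}) = u t + i v t. *)

Definition cmod {R : realType} (x y : R) : R := Num.sqrt (x ^+ 2 + y ^+ 2).

Definition abs_continuous_C {R : realType} (a b : R) (u v : R -> R) : Prop :=
  forall eps : R, 0 < eps -> exists2 delta : R, 0 < delta &
    forall (n : nat) (x y : nat -> R),
      (forall k, (k < n)%N -> a <= x k /\ x k <= y k /\ y k <= b) ->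
      (forall k, (k.+1 < n)%N -> y k <= x k.+1) ->
      \sum_(k < n) (y k - x k) < delta ->
      \sum_(k < n) cmod (u (y k) - u (x k)) (v (y k) - v (x k)) < eps.

Definition poisson_kernel {R : realType} (r s : R) : R :=
  (2 * pi)^-1 * ((1 - r ^+ 2) / (1 - 2 * r * cos s + r ^+ 2)).

Definition poisson_int {R : realType} (g : R -> R) (r theta : R) : R :=
  Rintegral (@lebesgue_measure R) `[0, 2 * pi]
    (fun t => poisson_kernel r (t - theta) * g t).

(* w = P[F] = P[u] + i P[v];  w_r = dw/dr at z = r e^{i theta}, as a pair (Re, Im) *)
Definition w_r_re {R : realType} (u : R -> R) (r theta : R) : R :=
  derive1 (fun rho => poisson_int u rho theta) r.

Definition abs_w_r {R : realType} (u v : R -> R) (r theta : R) : R :=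
  cmod (w_r_re u r theta) (w_r_re v r theta).

Definition abs_Fdot {R : realType} (u v : R -> R) (t : R) : R :=
  cmod (derive1 u t) (derive1 v t).

Definition atanh {R : realType} (r : R) : R := 2^-1 * ln ((1 + r) / (1 - r)).

Definition Cp {R : realType} (p : R) : \bar R :=
  (\int[@lebesgue_measure R]_(r in `]0%R, 1%R[) ((4 * atanh r / (pi * r)) `^ p * r)%:E)%E.

(* int_D |w_r|^p dA, with dA = (1/pi) r dr dtheta (polar coordinates z = r e^{i theta}) *)
Definition bergman_pow {R : realType} (u v : R -> R) (p : R) : \bar R :=
  (\int[(@lebesgue_measure R \x @lebesgue_measure R)%E]_(z in `]0%R, 1%R[ `*` `[0%R, (2 * pi)%R[)
     ((abs_w_r u v z.1 z.2) `^ p * (z.1 / pi))%:E)%E.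

Definition circle_pow {R : realType} (u v : R -> R) (p : R) : \bar R :=
  ((2 * pi)^-1%:E * \int[@lebesgue_measure R]_(t in `[0%R, (2 * pi)%R]) ((abs_Fdot u v t) `^ p)%:E)%E.

(* Main.v *)
Require Import Defs.
From HB Require Import structures.
From mathcomp Require Import all_boot all_order all_algebra.
From mathcomp Require Import all_classical all_reals all_analysis.
From mathcomp Require Import measurable_realfun ring lra.
Import Order.TTheory GRing.Theory Num.Theory.
Import numFieldNormedType.Exports.
Local Open Scope classical_set_scope.
Local Open Scope ring_scope.

(* Both [dP/dr] and [dK/ds] equal the same function, where [K = Q / r] is the
   conjugate Poisson kernel divided by [r].  Integrating by parts against the
   absolutely continuous periodic [F] gives
     [w_r (r e^{i theta}) = - int K_r (t - theta) F' (t) dt].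
   Since [int |K_r| = 4 atanh r / (pi r)], Jensen's inequality and Tonelli's
   theorem bound the [L^p] norm of [w_r] on the circle of radius [r] by
   [4 atanh r / (pi r)] times that of [F'], and it remains to integrate in [r].
   The integration by parts rests on the fundamental theorem of calculus for
   absolutely continuous functions: such an [f] is the difference of the
   nondecreasing absolutely continuous functions [TV f] and [TV f - f], whose
   Stieltjes measures are dominated by Lebesgue measure; their Radon-Nikodym
   densities differentiate back to [f'] at almost every point. *)

Set Implicit Arguments.
Unset Strict Implicit.
Unset Printing Implicit Defensive.

(** * Absolute continuity *)

(** The two derivatives agree because $2\pi(P+iQ)=(1+z)/(1-z)$ is holomorphic in $z=re^{is}$, and
    the polar Cauchy-Riemann equation reads $P_r=Q_s/r$. Bounding $P_r$ directly would not do: its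
    $L^1$ norm in the angle grows like $1/(1-r)$, whose $p$-th power is not integrable up to $r=1$.
    Once the derivative sits on $F$, the remaining kernel $K$ has a norm that grows only like
    $\log\frac{1}{1-r}$, and every power of that is integrable. The constant $4\tanh^{-1}r/(\pi r)$
    is twice the rise, between the angles $0$ and $\pi$, of a logarithmic primitive of $K$. The 2 in
    $2C(p)$ is the quotient of the weights $1/\pi$ of $dA$ and $1/(2\pi)$ of the circle norm.
    Absolute continuity is given on a segment, whereas Stieltjes measures and monotonicity are
    handled on the whole line; [clip] mediates between the two. Derivatives and integrals are taken
    of the real and imaginary parts separately, and the modulus is recovered by pairing $w_r$ with
    itself. *)

Section chains.
Context {R : realType}.
Implicit Types (a b x y : R) (p : R * R) (s t : seq (R * R)) (f g : R -> R).

(* Non-overlapping intervals listed from left to right, all to the right of [a]. *)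
Fixpoint chain a s : bool :=
  if s is p :: s' then [&& a <= p.1, p.1 <= p.2 & chain p.2 s'] else true.

Definition chain_end a s : R := last a (unzip2 s).

Definition chain_length s : R := \sum_(p <- s) (p.2 - p.1).

Definition chain_variation f s : R := \sum_(p <- s) `|f p.2 - f p.1|.

(** The chains may lie anywhere on the line, so no segment has to be carried along. Lists, unlike
    indexed families, can be concatenated and refined by recursion. *)
Definition abs_continuous f := forall e : R, 0 < e -> exists2 d : R, 0 < d &
  forall a s, chain a s -> chain_length s < d -> chain_variation f s < e.

Lemma chain_cat a s t : chain a (s ++ t) = chain a s && chain (chain_end a s) t.
Proof. by elim: s a => [//|p s IH] a /=; rewrite IH !andbA. Qed.

Lemma chain_length_cat s t : chain_length (s ++ t) = chain_length s + chain_length t.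
Proof. exact: big_cat. Qed.

Lemma chain_variation_cat f s t :
  chain_variation f (s ++ t) = chain_variation f s + chain_variation f t.
Proof. exact: big_cat. Qed.

Lemma chainW a b s : b <= a -> chain a s -> chain b s.
Proof.
by move=> ba; case: s => [//|p s] /= /and3P[ap -> ->]; rewrite (le_trans ba).
Qed.

Lemma chain_end_cat a s t : chain_end a (s ++ t) = chain_end (chain_end a s) t.
Proof. by rewrite /chain_end /unzip2 map_cat last_cat. Qed.

Lemma chain_end_le a b s : a <= b -> chain_end a s <= chain_end b s.
Proof. by case: s. Qed.

Lemma chain_catW a b s t : chain a s -> chain_end a s <= b -> chain b t ->
  chain a (s ++ t).
Proof. by rewrite chain_cat => -> /chainW; exact. Qed.

Lemma chain_end_ge a s : chain a s -> a <= chain_end a s.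
Proof.
rewrite /chain_end; elim: s a => [//|p s IH] a /= /and3P[ap pp /IH].
by apply: le_trans; exact: le_trans pp.
Qed.

Lemma chain_nth a s k : chain a s -> (k < size s)%N ->
  (nth (0, 0) s k).1 <= (nth (0, 0) s k).2.
Proof.
by elim: s a k => [//|p s IH] a [|k] /= /and3P[ap pp] // c; exact: IH c.
Qed.

Lemma chain_nthS a s k : chain a s -> (k.+1 < size s)%N ->
  (nth (0, 0) s k).2 <= (nth (0, 0) s k.+1).1.
Proof.
elim: s a k => [//|p s IH] a [|k] /= /and3P[ap pp] // c; last exact: IH c.
by case: s c {IH} => [//|q s] /= /and3P[].
Qed.

Lemma chain_in a s p : chain a s -> p \in s ->
  [/\ a <= p.1, p.1 <= p.2 & p.2 <= chain_end a s].
Proof.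
elim: s a => [//|q s IH] a /= /and3P[aq qq c]; rewrite inE => /predU1P[->|ps].
  by split => //; exact: chain_end_ge c.
have [qp pp pe] := IH _ c ps; split => //.
by rewrite (le_trans aq)// (le_trans qq).
Qed.

Lemma chain_map a s (h : R -> R) : {homo h : x y / x <= y} -> chain a s ->
  chain (h a) [seq (h p.1, h p.2) | p <- s].
Proof.
move=> hh; elim: s a => [//|q s IH] a /= /and3P[aq qq c].
by rewrite !hh//=; exact: IH.
Qed.

(* A function on [`[a, b]] is extended to the line as [f \o clip a b]. *)
Definition clip a b x := Num.max a (Num.min x b).

Lemma clip_homo a b : {homo clip a b : x y / x <= y}.
Proof.
move=> x y xy; rewrite /clip ge_max le_max lexx /=.
by rewrite le_max; apply/orP; right; rewrite le_min !ge_min xy lexx orbT.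
Qed.

Lemma clip_itv a b x : a <= b -> a <= clip a b x <= b.
Proof. by move=> ab; rewrite /clip le_max lexx ge_max ab ge_min lexx orbT. Qed.

Lemma clip_id a b x : a <= x -> x <= b -> clip a b x = x.
Proof. by move=> ax xb; rewrite /clip (min_l xb) (max_r ax). Qed.

Lemma clip_idem a b x : a <= b -> clip a b (clip a b x) = clip a b x.
Proof. by move=> /(clip_itv x)/andP[? ?]; rewrite clip_id. Qed.

Lemma clipB a b x y : x <= y -> clip a b y - clip a b x <= y - x.
Proof.
move=> xy; rewrite /clip /Num.max /Num.min.
by repeat case: ifPn; rewrite -?leNgt; lra.
Qed.

Lemma le_cmodl x y : `|x| <= cmod x y.
Proof. by rewrite /cmod -sqrtr_sqr ler_sqrt ?lerDl ?addr_ge0 ?sqr_ge0. Qed.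

Lemma cmodC x y : cmod x y = cmod y x.
Proof. by rewrite /cmod addrC. Qed.

(** By this symmetry, a result on the real part alone also serves for the imaginary part. *)
Lemma abs_continuous_CC a b f g :
  abs_continuous_C a b f g -> abs_continuous_C a b g f.
Proof.
move=> fg e e0; have [d d0 H] := fg _ e0; exists d => // n x y h1 h2 h3.
by under eq_bigr do rewrite cmodC; exact: H.
Qed.

Lemma chain_length_clip a b c s : chain c s ->
  chain_length [seq (clip a b p.1, clip a b p.2) | p <- s] <= chain_length s.
Proof.
move=> cs; rewrite /chain_length big_map !big_seq ler_sum// => p ps.
by have [_ pp _] := chain_in cs ps; exact: clipB.
Qed.

(** Clipping sends a chain to a chain inside [[a, b]] that is no longer, and a real part is bounded
    by the modulus. *)
Lemma abs_continuous_clip a b f g : a <= b -> abs_continuous_C a b f g ->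
  abs_continuous (f \o clip a b).
Proof.
move=> ab fg e e0; have [d d0 H] := fg _ e0; exists d => // c s cs sd.
pose t := [seq (clip a b p.1, clip a b p.2) | p <- s].
have ct : chain (clip a b c) t by apply: chain_map => //; exact: clip_homo.
have {}H := H (size t) (fun k => (nth (0, 0) t k).1) (fun k => (nth (0, 0) t k).2).
have -> : chain_variation (f \o clip a b) s = chain_variation f t.
  by rewrite /chain_variation big_map.
rewrite /chain_variation (big_nth (0, 0)) big_mkord.
have {H}: \sum_(k < size t) cmod (f (nth (0, 0) t k).2 - f (nth (0, 0) t k).1)
    (g (nth (0, 0) t k).2 - g (nth (0, 0) t k).1) < e.
  apply: H.
  - move=> k kt; split; last split; last 2 first.
    + exact: chain_nth ct _.
    + have ks : (k < size s)%N by move: kt; rewrite size_map.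
      rewrite (nth_map (0, 0) _ _ ks) [X in is_true X]/=.
      by have /andP[] := clip_itv (nth (0, 0) s k).2 ab.
    + have ks : (k < size s)%N by move: kt; rewrite size_map.
      rewrite (nth_map (0, 0) _ _ ks) [X in is_true X]/=.
      by have /andP[] := clip_itv (nth (0, 0) s k).1 ab.
  - by move=> k kt; exact: chain_nthS ct _.
  - apply: le_lt_trans sd; apply: le_trans (chain_length_clip a b cs).
    by rewrite /chain_length (big_nth (0, 0)) big_mkord.
by apply: le_lt_trans; apply: ler_sum => k _; exact: le_cmodl.
Qed.

Lemma abs_continuous_comp_clip a b f : a <= b -> abs_continuous f ->
  abs_continuous (f \o clip a b).
Proof.
move=> ab hf e e0; have [d d0 H] := hf _ e0; exists d => // c s cs sd.
pose t := [seq (clip a b p.1, clip a b p.2) | p <- s].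
have ct : chain (clip a b c) t by apply: chain_map => //; exact: clip_homo.
have -> : chain_variation (f \o clip a b) s = chain_variation f t.
  by rewrite /chain_variation big_map.
by apply: H ct _; apply: le_lt_trans sd; exact: chain_length_clip cs.
Qed.

Lemma lipschitz_abs_continuous f (C : R) : 0 < C ->
  (forall x y, x <= y -> `|f y - f x| <= C * (y - x)) -> abs_continuous f.
Proof.
move=> C0 H e e0; exists (e / C); first by rewrite divr_gt0.
move=> a s cs; rewrite ltr_pdivlMr// mulrC; apply: le_lt_trans.
rewrite /chain_variation /chain_length mulr_sumr !big_seq ler_sum// => p ps.
by have [_ pp _] := chain_in cs ps; exact: H.
Qed.

(** The bounds are required on the whole line; clipped continuous functions have them. *)
Lemma abs_continuousM f g (C : R) : 0 < C ->
  (forall x, `|f x| <= C) -> (forall x, `|g x| <= C) ->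
  abs_continuous f -> abs_continuous g -> abs_continuous (fun x => f x * g x).
Proof.
move=> C0 fC gC hf hg e e0.
have e20 : 0 < e / 2 / C by rewrite !divr_gt0.
have [d d0 Hd] := hf _ e20; have [d' d'0 Hd'] := hg _ e20.
exists (Num.min d d'); first by rewrite lt_min d0.
move=> a s cs; rewrite lt_min => /andP[/(Hd _ _ cs) + /(Hd' _ _ cs)].
rewrite !(ltr_pdivlMr _ _ C0) => h1 h2.
rewrite [ltRHS](splitr e); apply: le_lt_trans (ltrD h1 h2).
rewrite /chain_variation !mulr_suml -big_split ler_sum//= => p _.
rewrite [X in `|X|](_ : _ = (f p.2 - f p.1) * g p.2 + (g p.2 - g p.1) * f p.1); last by ring.
by rewrite (le_trans (ler_normD _ _))// !normrM lerD// ler_wpM2l.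
Qed.

Lemma abs_continuousD f g : abs_continuous f -> abs_continuous g ->
  abs_continuous (fun x => f x + g x).
Proof.
move=> hf hg e e0; have e20 : 0 < e / 2 by rewrite divr_gt0.
have [d d0 Hd] := hf _ e20; have [d' d'0 Hd'] := hg _ e20.
exists (Num.min d d'); first by rewrite lt_min d0.
move=> a s cs; rewrite lt_min => /andP[sd sd'].
rewrite [ltRHS](splitr e); apply: le_lt_trans (ltrD (Hd _ _ cs sd) (Hd' _ _ cs sd')).
rewrite /chain_variation -big_split ler_sum//= => p _.
by rewrite [X in `|X|](_ : _ = (f p.2 - f p.1) + (g p.2 - g p.1)) ?ler_normD//; ring.
Qed.

Lemma abs_continuousN f : abs_continuous f -> abs_continuous (fun x => - f x).
Proof.
move=> hf e e0; have [d d0 H] := hf _ e0; exists d => // a s cs sd.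
rewrite /chain_variation; under eq_bigr do rewrite -opprD normrN.
exact: H cs sd.
Qed.

Lemma abs_continuous_dist f : abs_continuous f -> forall e, 0 < e ->
  exists2 d, 0 < d & forall x y, x <= y -> y - x < d -> `|f y - f x| < e.
Proof.
move=> hf e e0; have [d d0 H] := hf _ e0; exists d => // x y xy xyd.
have := H x [:: (x, y)]; rewrite /chain_length /chain_variation !big_seq1/=.
by apply; rewrite ?lexx ?xy.
Qed.

Lemma abs_continuous_continuous f : abs_continuous f -> continuous f.
Proof.
move=> hf x; apply/cvgrPdist_lt => e e0.
have [d d0 H] := abs_continuous_dist hf e0.
near=> y; have yd : `|x - y| < d by near: y; apply/nbhs_ballP; exists d.
have [xy|/ltW yx] := leP x y; first rewrite distrC.
  by apply: H => //; apply: le_lt_trans yd; rewrite distrC ler_norm.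
by apply: H => //; apply: le_lt_trans yd; rewrite ler_norm.
Unshelve. all: by end_near. Qed.

(** Zipping a partition with its shift gives a chain without gaps; total variation is thereby
    expressed through chains. *)
Lemma partition_chain x (s : seq R) : path <%O x s ->
  [/\ chain x (zip (x :: s) s), chain_end x (zip (x :: s) s) = last x s &
    chain_length (zip (x :: s) s) = last x s - x].
Proof.
elim: s x => [|y s IH] x.
  by move=> _; split; rewrite // /chain_length/= big_nil subrr.
rewrite [path _ _ _]/= => /andP[xy /IH[cs es ls]]; split => /=.
- by rewrite lexx (ltW xy).
- by move: es; rewrite /chain_end.
- by rewrite /chain_length big_cons/= -/(chain_length _) ls; ring.
Qed.

Lemma variation_chain x y f (s : seq R) : itv_partition x y s ->
  variation x y f s = chain_variation f (zip (x :: s) s).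
Proof.
move=> xys; rewrite variation_zip//; case: xys => + _; rewrite /chain_variation.
elim: s x => [|z s IH] x /=; first by rewrite !big_nil.
by move=> /andP[_ /IH{}IH]; rewrite !big_cons/= IH.
Qed.

Lemma total_variation_chain_ge x y f e : x <= y -> 0 < e ->
  (total_variation x y f < +oo)%E ->
  exists s, [/\ chain x s, chain_end x s <= y, chain_length s = y - x &
     fine (total_variation x y f) - e < chain_variation f s].
Proof.
move=> xy e0 tvoo.
have tvfin : total_variation x y f \is a fin_num.
  by rewrite ge0_fin_numE// total_variation_ge0.
have [_ [_ [s ps <-] <-]] := ub_ereal_sup_adherent e0 tvfin.
rewrite -/(total_variation x y f) -(fineK tvfin) lte_fin variation_chain//.
case: ps => pxs /eqP lsy.
have [cs es ls] := partition_chain pxs.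
by exists (zip (x :: s) s); rewrite es ls lsy.
Qed.

Lemma total_variation_chain_le x y f (e : R) :
  (forall s, chain x s -> chain_length s = y - x -> chain_variation f s <= e) ->
  (total_variation x y f <= e%:E)%E.
Proof.
move=> H; apply: ge_ereal_sup => _ [_ [s ps <-] <-].
rewrite lee_fin variation_chain//; case: ps => pxs /eqP lsy.
have [cs es ls] := partition_chain pxs.
by apply: H => //; rewrite ls lsy.
Qed.

(** With the [d] that belongs to [e = 1], the variation over an interval of length [d / 2] is at
    most 1, and finitely many such intervals cover [[x, y]]. *)
Lemma abs_continuous_total_variation x y f : abs_continuous f -> x <= y ->
  (total_variation x y f < +oo)%E.
Proof.
move=> hf xy; have [d d0 H] := hf _ (@ltr01 R).
pose n := Num.bound ((y - x) / d).
have small z : (total_variation z (z + d / 2) f <= 1%:E)%E.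
  apply: total_variation_chain_le => s cs ls; apply/ltW/(H _ _ cs).
  by rewrite ls; lra.
have big k : (total_variation x (x + d / 2 *+ k) f <= k%:R%:E)%E.
  elim: k => [|k IH]; first by rewrite mulr0n addr0 total_variationxx.
  rewrite (@total_variationD _ _ _ (x + d / 2 *+ k)).
  - by rewrite (mulrSr (d / 2)) addrA -[k.+1%:R]natr1 EFinD leeD.
  - by rewrite lerDl mulrn_wge0// ltW// divr_gt0.
  - by rewrite lerD2l (mulrSr (d / 2)) lerDl ltW// divr_gt0.
(* The pieces have length [d / 2], hence twice as many as [n] counts. *)
have yn : y <= x + d / 2 *+ (n.*2).
  rewrite -mul2n mulrnA -[_ *+ 2]mulr_natr divfK ?pnatr_eq0//.
  rewrite -lerBlDl -mulr_natr mulrC -ler_pdivrMr//.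
  by apply/ltW/archi_boundP; rewrite divr_ge0 ?subr_ge0// ltW.
apply: (@le_lt_trans _ _ ((n.*2)%:R%:E : \bar R)); last exact: ltry.
apply: le_trans (big n.*2).
by rewrite (total_variationD f xy yn) leeDl// total_variation_ge0.
Qed.

End chains.

(** * Total variation of an absolutely continuous function *)

Section tv.
Context {R : realType}.
Implicit Types (a b x y : R) (p : R * R) (s t : seq (R * R)) (f g : R -> R).

(** Each interval is replaced by a partition that nearly attains its total variation, the allowed
    error being halved from one interval to the next. Since the length is unchanged, the [d] found
    for [f] can be used for its total variation. *)
Lemma total_variation_refine a s f e : abs_continuous f -> chain a s -> 0 < e ->
  exists t, [/\ chain a t, chain_end a t <= chain_end a s,
    chain_length t = chain_length s &
    \sum_(p <- s) fine (total_variation p.1 p.2 f) <= chain_variation f t + e].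
Proof.
move=> hf; elim: s a e => [|p s IH] a e.
  move=> _ e0; exists [::]; split => //.
  by rewrite /chain_variation !big_nil add0r ltW.
move=> /= /and3P[ap pp cs] e0; have e20 : 0 < e / 2 by rewrite divr_gt0.
have [t [ct et lt vt]] := IH _ _ cs e20.
have [r [cr er lr vr]] := total_variation_chain_ge pp e20
  (abs_continuous_total_variation hf pp).
exists (r ++ t); split.
- apply: chain_catW ct; first exact: chainW cr.
  exact: le_trans (chain_end_le _ ap) er.
- rewrite chain_end_cat [leRHS](_ : _ = chain_end p.2 s)//; apply: le_trans et.
  by apply: chain_end_le; exact: le_trans (chain_end_le _ ap) er.
- by rewrite chain_length_cat lr lt [in RHS]/chain_length big_cons.
- rewrite big_cons chain_variation_cat.
  have := ltW vr; rewrite lerBlDr => /lerD/(_ vt) /le_trans; apply.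
  by rewrite addrACA -splitr.
Qed.

(** Clipping makes it constant outside [[a, b]], so that it can be monotone on the whole line, as a
    cumulative function must be. *)
Definition tv_fun a b f x : R := fine (total_variation a (clip a b x) f).

Lemma tv_funB a b f x y : a <= b -> abs_continuous f -> x <= y ->
  tv_fun a b f y - tv_fun a b f x =
  fine (total_variation (clip a b x) (clip a b y) f).
Proof.
move=> ab hf xy; have /andP[ax _] := clip_itv x ab.
have xy' := clip_homo a b xy.
rewrite /tv_fun (total_variationD f ax xy') fineD; last 2 first.
- by rewrite ge0_fin_numE ?total_variation_ge0// abs_continuous_total_variation.
- by rewrite ge0_fin_numE ?total_variation_ge0// abs_continuous_total_variation.
by rewrite addrAC subrr add0r.
Qed.

Lemma tv_fun_ge a b f x y : a <= b -> abs_continuous f -> x <= y ->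
  `|f (clip a b y) - f (clip a b x)| <= tv_fun a b f y - tv_fun a b f x.
Proof.
move=> ab hf xy; rewrite tv_funB//; have xy' := clip_homo a b xy.
rewrite -lee_fin fineK ?total_variation_ge//.
by rewrite ge0_fin_numE ?total_variation_ge0// abs_continuous_total_variation.
Qed.

(** The [d] that [f] has for [e / 2] works: refining the clipped chain costs another [e / 2]. *)
Lemma abs_continuous_tv_fun a b f : a <= b -> abs_continuous f ->
  abs_continuous (tv_fun a b f).
Proof.
move=> ab hf e e0; have e20 : 0 < e / 2 by rewrite divr_gt0.
have [d d0 H] := hf _ e20; exists d => // c s cs sd.
pose t := [seq (clip a b p.1, clip a b p.2) | p <- s].
have ct : chain (clip a b c) t by apply: chain_map => //; exact: clip_homo.
have [r [cr er lr vr]] := total_variation_refine hf ct e20.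
have -> : chain_variation (tv_fun a b f) s =
    \sum_(p <- t) fine (total_variation p.1 p.2 f).
  rewrite /chain_variation big_map big_seq [RHS]big_seq.
  apply: eq_bigr => p ps; have [_ pp _] := chain_in cs ps.
  rewrite tv_funB// ger0_norm// fine_ge0// total_variation_ge0//.
  exact: clip_homo.
apply: le_lt_trans vr _; rewrite [ltRHS](splitr e) ltrD2r.
apply: H cr _; rewrite lr; apply: le_lt_trans sd.
exact: chain_length_clip cs.
Qed.

End tv.

(** * Stieltjes measures dominated by Lebesgue measure *)

Section insert.
Context {R : realType}.
Implicit Types (a b x y : R) (p : R * R) (s t : seq (R * R)) (f g : R -> R).

(** The intervals are open on the left and closed on the right, like those from which the outer
    measure is built. *)
Definition covered s (z : R) := has (fun p => p.1 < z <= p.2) s.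

Lemma covered0 : [set z | covered [::] z] = set0.
Proof. by apply/seteqP; split. Qed.

(* Overlapping intervals are merged, so that a cover by half-open intervals becomes
   a chain of no larger total length. *)
Fixpoint chain_insert x y s : seq (R * R) :=
  if s is p :: s' then
    if y <= p.1 then (x, y) :: s else
    if p.2 <= x then p :: chain_insert x y s' else
    chain_insert (Num.min x p.1) (Num.max y p.2) s'
  else [:: (x, y)].

Lemma chain_insertP a x y s : chain a s -> a <= x -> x <= y ->
  chain a (chain_insert x y s).
Proof.
elim: s a x y => [|p s IH] a x y /=; first by move=> _ -> ->.
move=> /and3P[ap pp cs] ax xy; case: ifPn => [yp|]; first by rewrite /= ax xy yp pp cs.
rewrite -ltNge => py; case: ifPn => [px|]; first by rewrite /= ap pp IH.
move=> _; apply: IH; first by rewrite (chainW _ cs)// (le_trans ap).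
  by rewrite le_min ax.
by rewrite ge_min le_max xy.
Qed.

Lemma chain_length_insert a x y s : chain a s -> x <= y ->
  chain_length (chain_insert x y s) <= (y - x) + chain_length s.
Proof.
elim: s a x y => [|p s IH] a x y /=.
  by move=> _ _; rewrite /chain_length big_seq1 big_nil addr0.
move=> /and3P[ap pp cs] xy; case: ifPn => [yp|].
  by rewrite /chain_length big_cons.
rewrite -ltNge => py; case: ifPn => [px|].
  rewrite /chain_length !big_cons -!/(chain_length _).
  by have := IH _ _ _ cs xy; lra.
rewrite -ltNge => xp; rewrite [in leRHS]/chain_length big_cons -/(chain_length _).
(* The two intervals overlap here, so their hull is no longer than both together. *)
apply: le_trans (IH _ _ _ cs _) _; first by rewrite ge_min le_max xy.
by rewrite /Num.min /Num.max; repeat case: ifPn; rewrite -?leNgt; lra.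
Qed.

Lemma covered_insert x y s z : (x < z <= y) || covered s z ->
  covered (chain_insert x y s) z.
Proof.
elim: s x y => [|p s IH] x y //=.
case: ifPn => [yp|]; first by rewrite /covered/=.
rewrite -ltNge => py; case: ifPn => [px|].
  rewrite /covered /= orbCA => /orP[->//|h]; apply/orP; right; exact: IH.
rewrite -ltNge => xp h; apply: IH; rewrite gt_min le_max.
move: h; rewrite {1}/covered/= => /or3P[/andP[-> ->]|/andP[-> ->]|];
  by rewrite ?orbT//= /covered => ->; rewrite orbT.
Qed.

Notation mu := (@lebesgue_measure R).

Lemma stieltjes_itv (F : cumulative R R) x y : x <= y ->
  lebesgue_stieltjes_measure F `]x, y] = (F y - F x)%:E.
Proof.
move=> xy; rewrite /lebesgue_stieltjes_measure /= /measure_extension.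
rewrite measurable_mu_extE//=; last exact: is_ocitv.
by rewrite wlength_itv_bnd.
Qed.

Lemma covered_measurable s :
  measurable ([set z | covered s z] : set (measurableTypeR R)).
Proof.
elim: s => [|p s IH]; first by rewrite covered0.
rewrite (_ : [set _ | _] = `]p.1, p.2] `|` [set z | covered s z]).
  by apply: measurableU => //; exact: measurable_itv.
by apply/seteqP; split => z /=; rewrite in_itv/= => /orP.
Qed.

Lemma stieltjes_covered (F : cumulative R R) a s : chain a s ->
  (lebesgue_stieltjes_measure F [set z | covered s z] <=
    (chain_variation F s)%:E)%E.
Proof.
elim: s a => [|p s IH] a.
  by rewrite covered0 measure0 /chain_variation big_nil.
move=> /= /and3P[ap pp cs].
rewrite (_ : [set _ | _] = `]p.1, p.2] `|` [set z | covered s z]).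
  apply: le_trans.
    apply: (@measureU2 _ _ _ (lebesgue_stieltjes_measure F)).
      exact: measurable_itv.
    exact: covered_measurable.
  rewrite /chain_variation big_cons EFinD leeD ?(IH _ cs)//.
  apply: (@le_trans _ _ (F p.2 - F p.1)%:E); last by rewrite lee_fin ler_norm.
  by rewrite le_eqVlt; apply/orP; left; apply/eqP; exact: stieltjes_itv.
by apply/seteqP; split => z /=; rewrite in_itv/= => /orP.
Qed.

(** The intervals of a cover come in no order and may overlap; inserting them one by one makes
    absolute continuity applicable. *)
Lemma chain_of_cover (A : (set R)^nat) n : (forall i, ocitv (A i)) ->
  exists a s, [/\ chain a s,
    \big[setU/set0]_(i < n) A i `<=` [set z | covered s z] &
    ((chain_length s)%:E <= \sum_(i < n) wlength idfun (A i))%E].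
Proof.
move=> oA; elim: n => [|n [a [s [cs As ls]]]].
  exists 0, [::]; split => //; first by rewrite big_ord0.
  by rewrite big_ord0 /chain_length big_nil.
have /ocitvP[A0|[[x y] /= xy Axy]] := oA n.
  exists a, s; split => //; first by rewrite big_ord_recr/= A0 setU0.
  by rewrite big_ord_recr/= A0 wlength0 adde0.
exists (Num.min a x), (chain_insert x y s); split.
- apply: chain_insertP; [|by rewrite ge_min lexx orbT|exact: ltW].
  by apply: chainW cs; rewrite ge_min lexx.
- rewrite big_ord_recr/= => z [/As/= h|]; first by apply: covered_insert; rewrite h orbT.
  by rewrite Axy/= in_itv/= => h; apply: covered_insert; rewrite h.
- rewrite big_ord_recr/= Axy wlength_itv_bnd; last exact: ltW.
  apply: le_trans (leeD ls (lexx _)); rewrite -EFinD lee_fin [leRHS]addrC.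
  exact: chain_length_insert cs (ltW xy).
Qed.

(** A null set has a countable cover by half-open intervals of total length below [d]. Chains are
    finite, so the estimate by [e] is made for the finite unions of the cover, and continuity from
    below carries it to the whole union. *)
Lemma stieltjes_dominates (F : cumulative R R) : abs_continuous F ->
  lebesgue_stieltjes_measure F `<< mu.
Proof.
move=> hF; apply/null_content_dominatesP => N mN N0.
apply/eqP; rewrite eq_le measure_ge0 andbT; apply/lee_addgt0Pr => e e0.
rewrite add0e; have [d d0 H] := hF _ e0.
have mu0 : mu_ext (wlength idfun : set (ocitv_type R) -> \bar R) N = 0%E by rewrite -N0.
have mufin : mu_ext (wlength idfun : set (ocitv_type R) -> \bar R) N \is a fin_num.
  by rewrite mu0.
have [_ [A [mA NA] <-]] := lb_ereal_inf_adherent d0 mufin.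
rewrite -/(mu_ext _ _) mu0 add0e => Ad.
have mA' i : measurable (A i : set (measurableTypeR R)) by exact: sub_sigma_algebra.
apply: (@le_trans _ _ (lebesgue_stieltjes_measure F (\bigcup_i A i))).
  by apply: le_measure => //; rewrite inE//; exact: bigcup_measurable.
rewrite -bigcup_bigsetU_bigcup.
have mB n : measurable (\big[setU/set0]_(i < n) A i : set (measurableTypeR R)).
  exact: bigsetU_measurable.
have hB : {homo (fun n => \big[setU/set0]_(i < n.+1) A i) :
    m n / (m <= n)%N >-> (m <= n)%O}.
  by move=> m n mn; apply/subsetPset; exact: subset_bigsetU.
have cB := @nondecreasing_cvg_mu _ _ _ (lebesgue_stieltjes_measure F)
  (fun n => \big[setU/set0]_(i < n.+1) A i) (fun n => mB _)
  (bigcup_measurable (fun n _ => mB _)) hB.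
rewrite -(cvg_lim _ cB)//.
apply: lime_le; first exact: cvgP cB.
apply: nearW => n /=.
have [a [s [cs As ls]]] := chain_of_cover n.+1 mA.
apply: (@le_trans _ _ (lebesgue_stieltjes_measure F [set z | covered s z])).
  apply: le_measure => //; rewrite inE; [exact: mB|exact: covered_measurable].
apply: le_trans (stieltjes_covered F cs) _.
rewrite lee_fin; apply/ltW/(H _ _ cs).
rewrite -lte_fin; apply: le_lt_trans ls _; apply: le_lt_trans Ad.
rewrite -(big_mkord xpredT (fun i => wlength idfun (A i))).
by apply: nneseries_lim_ge => k _ _; exact: wlength_ge0.
Qed.

End insert.

(** * The fundamental theorem of calculus *)

Section density.
Context {R : realType}.
Implicit Types (a b x y : R) (f g : R -> R).
Notation mu := (@lebesgue_measure R).

Lemma nondecreasing_density a b f : a <= b ->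
  {homo f : x y / x <= y} -> abs_continuous f ->
  exists2 g : R -> R, mu.-integrable setT (EFin \o g) &
    forall x, a <= x -> x <= b -> f x - f a = \int[mu]_(t in `]a, x]) g t.
Proof.
move=> ab ndf hf.
have rc : right_continuous f.
  by apply: right_continuousW; exact: abs_continuous_continuous.
pose F : cumulative R R := HB.pack f (isCumulative.Build R _ R f ndf rc).
have mab : measurable (`]a, b]%classic : set (measurableTypeR R)).
  exact: measurable_itv.
have Foo : (lebesgue_stieltjes_measure F `]a, b]%classic < +oo)%E.
  by have -> := stieltjes_itv F ab; exact: ltry.
(* The restriction to []a, b]] makes the measure finite, as the Radon-Nikodym theorem requires, and
   the density integrable on the line. *)
pose nu : {finite_measure set (measurableTypeR R) -> \bar R} := mfrestr mab Foo.
have numu : nu `<< mu.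
  apply/null_content_dominatesP => N mN N0.
  have /null_content_dominatesP := @stieltjes_dominates R F hf; apply.
    exact: measurableI.
  apply/eqP; rewrite eq_le measure_ge0 andbT -N0.
  by apply: le_measure; rewrite ?inE//; exact: measurableI.
have [h [h0 hfin ih hE]] := radon_nikodym_sigma_finite numu.
exists (fine \o h).
  by apply: eq_integrable ih => // x _ /=; rewrite fineK.
move=> x ax xb; rewrite /Rintegral.
have -> : (\int[mu]_(t in `]a, x]) (EFin \o (fine \o h)) t)%E =
    (\int[mu]_(t in `]a, x]) h t)%E.
  by apply: eq_integral => t _ /=; rewrite fineK.
rewrite -hE; last exact: measurable_itv.
have -> : nu `]a, x]%classic = lebesgue_stieltjes_measure F `]a, x]%classic.
  rewrite /nu/= /mfrestr /mrestr setIidl//.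
  by apply: subset_itvl; rewrite bnd_simp.
by have -> := stieltjes_itv F ax.
Qed.

Lemma abs_continuous_density a b f : a <= b -> abs_continuous f ->
  exists2 g : R -> R, mu.-integrable setT (EFin \o g) &
    forall x, a <= x -> x <= b -> f x - f a = \int[mu]_(t in `]a, x]) g t.
Proof.
move=> ab hf; have hT := abs_continuous_tv_fun ab hf.
have ndT : {homo tv_fun a b f : x y / x <= y}.
  by move=> x y xy; rewrite -subr_ge0; apply: le_trans (tv_fun_ge ab hf xy).
(* Beyond [[a, b]] the total variation is constant; [f] is clipped so that the difference stays
   nondecreasing there. *)
pose S x := tv_fun a b f x - f (clip a b x).
have hfc : abs_continuous (f \o clip a b) by exact: abs_continuous_comp_clip.
have hS : abs_continuous S.
  exact: abs_continuousD hT (abs_continuousN hfc).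
have ndS : {homo S : x y / x <= y}.
  move=> x y xy; rewrite -subr_ge0 /S.
  by have := tv_fun_ge ab hf xy; rewrite ler_norml => /andP[]; lra.
have [g1 ig1 g1E] := nondecreasing_density ab ndT hT.
have [g2 ig2 g2E] := nondecreasing_density ab ndS hS.
exists (g1 \- g2).
  by apply: eq_integrable (integrableB _ ig1 ig2).
move=> x ax xb; rewrite RintegralB; last 3 first.
- exact: measurable_itv.
- exact: (integrableS measurableT).
- exact: (integrableS measurableT).
by rewrite -g1E// -g2E// /S !clip_id//; ring.
Qed.

(** The derivative is that of [f] itself, not of its clipped version. This is legitimate on the open
    interval, where the two agree near each point; at [a] and [b] it would involve values of [f]
    outside the segment. *)
Lemma abs_continuous_FTC a b f : a < b -> abs_continuous (f \o clip a b) ->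
  exists2 g : R -> R, mu.-integrable `[a, b] (EFin \o g) &
    {ae mu, forall x, x \in `]a, b[ -> derivable f x 1 /\ derive1 f x = g x} /\
    \int[mu]_(t in `[a, b]) g t = f b - f a.
Proof.
move=> ab /(abs_continuous_density (ltW ab))[g ig gE]; have ab' := ltW ab; exists g.
  by apply: (integrableS measurableT).
split; last first.
  have := gE b (ltW ab) (lexx _); rewrite /= !clip_id// => ->.
  rewrite Rintegral_itv_obnd_cbnd//.
  exact: (integrableS measurableT).
have : {ae mu, forall x, (BRight a < BRight x)%E -> derivable
    (fun y => \int[mu]_(t in `]a, y]) g t) x 1 /\
    derive1 (fun y => \int[mu]_(t in `]a, y]) g t) x = g x}.
  apply: FTC1; first by move=> y; exact: (integrableS measurableT).
  exact: (open_integrable_locally openT).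
apply: filterS; first exact: (ae_filter_ringOfSetsType mu).
move=> x H; rewrite in_itv/= => /andP[ax xb].
have {H} [] := H ax.
set G := fun y => \int[mu]_(t in `]a, y]) g t => dG GE.
have nG : \forall y \near x, G y + f a = f y.
  near=> y.
  have /[!in_itv]/= /andP[/ltW ay /ltW yb] : y \in `]a, b[.
    by near: y; apply: near_in_itvoo; rewrite in_itv/= ax xb.
  by have := gE y ay yb; rewrite /= !clip_id// /G => <-; rewrite subrK.
have dGa : is_derive x 1 (fun y => G y + f a) (g x).
  rewrite -[g x]addr0; apply: is_deriveD.
  by apply: DeriveDef; [exact: dG|rewrite -derive1E; exact: GE].
have df : is_derive x 1 f (g x).
  by apply: near_eq_is_derive dGa; rewrite ?oner_eq0//; near do apply/esym.
by split; [exact: ex_derive|rewrite derive1E; exact: derive_val].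
Unshelve. all: by end_near. Qed.

Lemma ae_neq a : {ae mu, forall x : R, x != a}.
Proof.
exists [set a]; split => //; first exact: lebesgue_measure_set1.
by move=> x /= /negP; rewrite negbK => /eqP.
Qed.

Lemma ae_itv_oo_cc a b (P : R -> Prop) :
  {ae mu, forall x, x \in `]a, b[ -> P x} -> {ae mu, forall x, x \in `[a, b] -> P x}.
Proof.
apply: filterS3 (ae_neq a) (ae_neq b); first exact: (ae_filter_ringOfSetsType mu).
move=> x xa xb; move=> + xab; apply; move: xab.
by rewrite !in_itv/= !le_eqVlt eq_sym (negbTE xa) (negbTE xb).
Qed.

(** Measurability of [f] is assumed separately: the Borel sets are not complete, so it does not
    follow from almost everywhere equality with [g]. *)
Lemma integrable_ae_eq (D : set (measurableTypeR R)) f g : measurable D ->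
  mu.-integrable D (EFin \o g) -> measurable_fun D f ->
  {ae mu, forall x, D x -> f x = g x} -> mu.-integrable D (EFin \o f).
Proof.
move=> mD /integrableP[mg ig] mf fg; apply/integrableP; split.
  exact/measurable_EFinP.
have -> : (\int[mu]_(x in D) `|(EFin \o f) x| = \int[mu]_(x in D) `|(EFin \o g) x|)%E; last by [].
apply: ae_eq_integral => //.
- by apply: measurableT_comp => //; exact/measurable_EFinP.
- exact: measurableT_comp.
- apply: filterS fg; first exact: (ae_filter_ringOfSetsType mu).
  by move=> x H Dx /=; rewrite H.
Qed.

Lemma Rintegral_ae_eq (D : set (measurableTypeR R)) f g : measurable D ->
  measurable_fun D f -> measurable_fun D g ->
  {ae mu, forall x, D x -> f x = g x} ->
  \int[mu]_(x in D) f x = \int[mu]_(x in D) g x.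
Proof.
move=> mD mf mg fg; rewrite /Rintegral; congr fine.
apply: ae_eq_integral => //; [exact/measurable_EFinP..|].
apply: filterS fg; first exact: (ae_filter_ringOfSetsType mu).
by move=> x H Dx /=; rewrite H.
Qed.

End density.

(** * The conjugate Poisson kernel *)

Section kernel.
Context {R : realType}.
Implicit Types (r s t x y theta : R).
Notation mu := (@lebesgue_measure R).

(** This is $|1-re^{is}|^2$. *)
Definition poisson_den r s : R := 1 - 2 * r * cos s + r ^+ 2.

(* The conjugate Poisson kernel divided by [r]. *)
Definition conj_kernel r s : R := pi^-1 * (sin s / poisson_den r s).

(* Both [d/ds] of [conj_kernel r s] and [d/dr] of [poisson_kernel r s]. *)
Definition conj_kernel' r s : R :=
  pi^-1 * ((cos s * (1 + r ^+ 2) - 2 * r) / poisson_den r s ^+ 2).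

Lemma pi_neq0 : pi != 0 :> R.
Proof. by rewrite gt_eqF ?pi_gt0. Qed.

Lemma sin_ge0_0pi t : 0 <= t -> t <= pi -> 0 <= sin t.
Proof. by move=> t0 tp; apply: sin_ge0_pi; rewrite t0. Qed.

Lemma poisson_den_ge r s : 0 <= r -> (1 - r) ^+ 2 <= poisson_den r s.
Proof.
move=> r0; rewrite -subr_ge0 (_ : _ - _ = 2 * (r * (1 - cos s))).
  by rewrite !mulr_ge0// subr_ge0 cos_le1.
by rewrite /poisson_den; ring.
Qed.

Lemma poisson_den_gt0 r s : 0 <= r -> r < 1 -> 0 < poisson_den r s.
Proof.
by move=> r0 r1; apply: lt_le_trans (poisson_den_ge s r0); rewrite exprn_gt0 ?subr_gt0.
Qed.

Lemma poisson_den_neq0 r s : 0 <= r -> r < 1 -> poisson_den r s != 0.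
Proof. by move=> r0 r1; rewrite gt_eqF// poisson_den_gt0. Qed.

Lemma is_derive_poisson_den_angle r s :
  is_derive s 1 (poisson_den r) (2 * r * sin s).
Proof.
rewrite /poisson_den; apply: is_derive_eq.
by rewrite /GRing.scale/=; ring.
Qed.

Lemma is_derive_poisson_den_radius r s :
  is_derive r 1 (poisson_den ^~ s) (2 * (r - cos s)).
Proof.
rewrite /poisson_den; apply: is_derive_eq.
by rewrite /GRing.scale/=; ring.
Qed.

Lemma is_derive_conj_kernel r s : 0 <= r -> r < 1 ->
  is_derive s 1 (conj_kernel r) (conj_kernel' r s).
Proof.
move=> r0 r1; have d0 := poisson_den_neq0 s r0 r1.
have := is_derive_poisson_den_angle r s.
move=> /(is_deriveV d0) dV.
rewrite /conj_kernel; apply: is_derive_eq.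
have cs := cos2Dsin2 s.
rewrite /conj_kernel' /GRing.scale/=.
have sE : sin s ^+ 2 = 1 - cos s ^+ 2 by rewrite -cs; ring.
(* The right-hand side is the numerator that the quotient rule produces. *)
have -> : cos s * (1 + r ^+ 2) - 2 * r =
  cos s * poisson_den r s - 2 * r * sin s ^+ 2.
  by rewrite sE /poisson_den; ring.
have := pi_neq0; move: (@pi R) => q pn0.
by field; rewrite ?d0 ?pn0.
Qed.

Lemma is_derive_poisson_kernel r s : 0 <= r -> r < 1 ->
  is_derive r 1 (poisson_kernel ^~ s) (conj_kernel' r s).
Proof.
move=> r0 r1; have d0 := poisson_den_neq0 s r0 r1.
have dV := @is_deriveV _ (poisson_den ^~ s) _ _ 1 d0 (is_derive_poisson_den_radius r s).
rewrite /poisson_kernel -/(poisson_den _ _).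
have -> : (fun x : R => (2 * pi)^-1 * ((1 - x ^+ 2) / (1 - 2 * x * cos s + x ^+ 2)))
  = (fun x : R => (2 * pi)^-1 * ((1 - x ^+ 2) * (poisson_den x s)^-1)) by [].
apply: is_derive_eq; rewrite /conj_kernel' /GRing.scale/=.
(* Half the numerator of the quotient rule; the other factor 2 cancels against $(2\pi)^{-1}$. *)
have -> : cos s * (1 + r ^+ 2) - 2 * r =
  - r * poisson_den r s - (1 - r ^+ 2) * (r - cos s).
  by rewrite /poisson_den; ring.
have := pi_neq0; move: (@pi R) => q pn0.
by field; rewrite ?d0 ?pn0.
Qed.

Lemma continuous_conj_kernel r : 0 <= r -> r < 1 -> continuous (conj_kernel r).
Proof.
move=> r0 r1 s; apply: differentiable_continuous; apply/derivable1_diffP.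
by have [] := is_derive_conj_kernel s r0 r1.
Qed.

Lemma continuous_conj_kernel' r : 0 <= r -> r < 1 -> continuous (conj_kernel' r).
Proof.
move=> r0 r1 s; apply: cvgM; first exact: cvg_cst.
have cd : poisson_den r x @[x --> s] --> poisson_den r s.
  apply: differentiable_continuous; apply/derivable1_diffP.
  by have [] := is_derive_poisson_den_angle r s.
apply: cvgM; last first.
  by apply: cvgV; [rewrite expf_neq0// poisson_den_neq0|exact: cvgM].
apply: cvgB; last exact: cvg_cst.
by apply: cvgM; [exact: continuous_cos|exact: cvg_cst].
Qed.

(** The numerator is at most 4 in absolute value and the denominator at least $(1-r)^4$. Being
    uniform in [s] and increasing in [r], the bound serves as a Lipschitz constant and as a
    dominating function. *)
Lemma conj_kernel'_le r s : 0 <= r -> r < 1 ->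
  `|conj_kernel' r s| <= pi^-1 * (4 / (1 - r) ^+ 4).
Proof.
move=> r0 r1; rewrite /conj_kernel' normrM ger0_norm ?invr_ge0 ?pi_ge0//.
rewrite ler_wpM2l ?invr_ge0 ?pi_ge0// normrM normfV; apply: ler_pM => //.
  rewrite (le_trans (ler_normB _ _))// normrM.
  have := cos_max s; rewrite (ger0_norm (_ : 0 <= 1 + r ^+ 2)); last first.
    by rewrite addr_ge0// sqr_ge0.
  rewrite (ger0_norm (_ : 0 <= 2 * r)) ?mulr_ge0// => c1.
  have r2 : r ^+ 2 <= 1 by rewrite expr_le1// ltW.
  have : `|cos s| * (1 + r ^+ 2) <= 1 * (1 + 1).
    by apply: ler_pM => //; [rewrite addr_ge0 ?sqr_ge0|rewrite lerD2l].
  lra.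
have d0 := poisson_den_gt0 s r0 r1.
rewrite (ger0_norm (sqr_ge0 _)) lef_pV2 ?posrE ?exprn_gt0 ?subr_gt0//.
rewrite (_ : (1 - r) ^+ 4 = ((1 - r) ^+ 2) ^+ 2); last by rewrite -exprM.
by rewrite ler_sqr ?nnegrE ?sqr_ge0 ?poisson_den_ge// ltW.
Qed.

Lemma conj_kernelD2pi r s : conj_kernel r (s + 2 * pi) = conj_kernel r s.
Proof. by rewrite /conj_kernel /poisson_den mulr_natl sinD2pi cosD2pi. Qed.

Lemma conj_kernelN r s : conj_kernel r (- s) = - conj_kernel r s.
Proof. by rewrite /conj_kernel /poisson_den sinN cosN mulNr mulrN. Qed.

(** A primitive of [conj_kernel r], because [poisson_den r] has derivative $2r\sin s$. *)
Definition log_den r s : R := (2 * pi * r)^-1 * ln (poisson_den r s).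

Lemma is_derive_log_den r s : 0 < r -> r < 1 ->
  is_derive s 1 (log_den r) (conj_kernel r s).
Proof.
move=> r0 r1; have d0 := poisson_den_gt0 s (ltW r0) r1.
have := is_derive_poisson_den_angle r s.
move=> /(is_derive1_comp (is_derive1_ln d0)) dV.
rewrite /log_den.
have -> : (fun s : R => (2 * pi * r)^-1 * ln (poisson_den r s)) =
  (fun s : R => (2 * pi * r)^-1 * (@ln R \o poisson_den r) s) by [].
apply: is_derive_eq; rewrite /GRing.scale/= /conj_kernel.
have rn0 : r != 0 by rewrite gt_eqF.
have dn0 : poisson_den r s != 0 by rewrite gt_eqF.
have := pi_neq0; move: (@pi R) => q pn0.
by field; rewrite ?pn0 ?rn0 ?dn0.
Qed.

(** The kernel has the sign of the sine, so where the sine keeps the sign $(-1)^b$, the absolute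
    value is removed at the price of this factor. *)
Lemma integral_norm_conj_kernel_itv r theta x y (b : bool) : 0 < r -> r < 1 ->
  x <= y -> (forall t, x <= t -> t <= y -> 0 <= (-1) ^+ b * sin (t - theta)) ->
  \int[mu]_(t in `[x, y]) `|conj_kernel r (t - theta)| =
  (-1) ^+ b * (log_den r (y - theta) - log_den r (x - theta)).
Proof.
move=> r0 r1; rewrite le_eqVlt => /predU1P[->|xy] H.
  by rewrite set_itv1 Rintegral_set1 subrr mulr0.
have dL t : is_derive t 1 (fun t => (-1) ^+ b * log_den r (t - theta))
    ((-1) ^+ b * conj_kernel r (t - theta)).
  have dK := is_derive_log_den (t - theta) r0 r1.
  have dB : is_derive t (1 : R) (fun t => t - theta) 1.
    by apply: is_derive_eq; rewrite subr0.
  have dC := @is_derive1_comp _ (log_den r) (fun t => t - theta) _ _ _ dK dB.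
  have -> : (fun t => (-1) ^+ b * log_den r (t - theta)) =
    (fun t => (-1) ^+ b * (log_den r \o (fun t => t - theta)) t) by [].
  by apply: is_derive_eq; rewrite /GRing.scale/= mulr1.
have cK : continuous (fun t => (-1) ^+ b * conj_kernel r (t - theta)).
  move=> t; apply: cvgM; first exact: cvg_cst.
  apply: (@continuous_comp _ _ _ (fun t => t - theta) (conj_kernel r)).
    by apply: cvgB; [exact: cvg_id|exact: cvg_cst].
  exact: continuous_conj_kernel (ltW r0) r1 _.
have cL : continuous (fun t => (-1) ^+ b * log_den r (t - theta)).
  move=> t; apply: differentiable_continuous; apply/derivable1_diffP.
  by have [] := dL t.
have -> : \int[mu]_(t in `[x, y]) `|conj_kernel r (t - theta)| =
    \int[mu]_(t in `[x, y]) ((-1) ^+ b * conj_kernel r (t - theta)).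
  apply: eq_Rintegral => t; rewrite inE/= in_itv/= => /andP[xt ty].
  have Kb : 0 <= (-1) ^+ b * conj_kernel r (t - theta).
    rewrite /conj_kernel mulrCA mulr_ge0 ?invr_ge0 ?pi_ge0// mulrA.
    by rewrite divr_ge0 ?H// ltW// poisson_den_gt0// ltW.
  by rewrite -[RHS]ger0_norm// normrMsign.
rewrite /Rintegral (@continuous_FTC2 _ _ (fun t => (-1) ^+ b * log_den r (t - theta)))//=.
- by ring.
- exact: continuous_subspaceT.
- split.
  + by move=> t _; have [] := dL t.
  + by apply: cvg_at_right_filter; exact: cL.
  + by apply: cvg_at_left_filter; exact: cL.
- by move=> t _; rewrite derive1E; have [] := dL t.
Qed.

Lemma sin_le0_Npi t : - pi <= t -> t <= 0 -> sin t <= 0.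
Proof. by move=> t1 t0; rewrite -oppr_ge0 -sinN sin_ge0_0pi//; lra. Qed.

Lemma log_denN r s : log_den r (- s) = log_den r s.
Proof. by rewrite /log_den /poisson_den cosN. Qed.

Lemma log_denD2pi r s : log_den r (s + 2 * pi) = log_den r s.
Proof. by rewrite /log_den /poisson_den mulr_natl cosD2pi. Qed.

(** At [pi] and [0] the denominator is $(1+r)^2$ and $(1-r)^2$, so the logarithms combine into the
    inverse hyperbolic tangent. *)
Lemma log_den_pi r : 0 < r -> r < 1 ->
  2 * (log_den r pi - log_den r 0) = 4 * atanh r / (pi * r).
Proof.
move=> r0 r1; rewrite /log_den /poisson_den cospi cos0 /atanh.
have -> : 1 - 2 * r * -1 + r ^+ 2 = (1 + r) ^+ 2 by ring.
have -> : 1 - 2 * r * 1 + r ^+ 2 = (1 - r) ^+ 2 by ring.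
have r1' : 0 < 1 - r by rewrite subr_gt0.
have r0' : 0 < 1 + r by rewrite addr_gt0.
rewrite !lnXn// ln_div ?posrE//.
have rn0 : r != 0 by rewrite gt_eqF.
have := pi_neq0; move: (@pi R) => q pn0.
by field; rewrite ?pn0 ?rn0.
Qed.

(** The segment is cut at the zeros of $\sin(t-\theta)$, namely [theta] and whichever of
    [theta + pi], [theta - pi] falls inside. As the primitive is even and periodic, its values at
    the ends [0] and [2 * pi] cancel, and twice its rise from [0] to [pi] remains. *)
Lemma integral_norm_conj_kernel r theta : 0 < r -> r < 1 ->
  0 <= theta -> theta <= 2 * pi ->
  \int[mu]_(t in `[0, 2 * pi]) `|conj_kernel r (t - theta)| =
  4 * atanh r / (pi * r).
Proof.
move=> r0 r1 th0 th1; rewrite -log_den_pi//.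
have pi0 := pi_ge0 R.
have cK : continuous (fun t => `|conj_kernel r (t - theta)|).
  move=> t; apply: cvg_norm.
  apply: (@continuous_comp _ _ _ (fun t => t - theta) (conj_kernel r)).
    by apply: cvgB; [exact: cvg_id|exact: cvg_cst].
  exact: continuous_conj_kernel (ltW r0) r1 _.
have iK x y : mu.-integrable `[x, y] (EFin \o (fun t => `|conj_kernel r (t - theta)|)).
  by apply: continuous_compact_integrable; [exact: segment_compact|exact: continuous_subspaceT].
have split3 x y : 0 <= x -> x <= y -> y <= 2 * pi ->
   \int[mu]_(t in `[0, 2 * pi]) `|conj_kernel r (t - theta)| =
   \int[mu]_(t in `[0, x]) `|conj_kernel r (t - theta)| +
   \int[mu]_(t in `[x, y]) `|conj_kernel r (t - theta)| +
   \int[mu]_(t in `[y, 2 * pi]) `|conj_kernel r (t - theta)|.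
  have split2 a b c : a <= b -> b <= c ->
     \int[mu]_(t in `[a, c]) `|conj_kernel r (t - theta)| =
     \int[mu]_(t in `[a, b]) `|conj_kernel r (t - theta)| +
     \int[mu]_(t in `[b, c]) `|conj_kernel r (t - theta)|.
    move=> ab bc; rewrite -(@Rintegral_itv_obnd_cbnd _ b).
      by rewrite -(@Rintegral_itvB _ _ (BLeft a) (BRight c) b)// ?bnd_simp//; ring.
    by apply: integrableS (iK b c) => //; apply: subset_itvr; rewrite bnd_simp.
  by move=> x0 xy y2; rewrite (split2 0 y) ?(le_trans x0)// (split2 0 x y).
have [tp|pt] := leP theta pi.
- rewrite (split3 theta (theta + pi)) ?lerDl//; [|lra].
  rewrite (@integral_norm_conj_kernel_itv r theta 0 theta true)//; last first.
    by move=> t t0 tt; rewrite expr1 mulN1r oppr_ge0 sin_le0_Npi//; lra.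
  rewrite (@integral_norm_conj_kernel_itv r theta theta (theta + pi) false) ?lerDl//; last first.
    by move=> t t0 tt; rewrite expr0 mul1r sin_ge0_0pi//; lra.
  rewrite (@integral_norm_conj_kernel_itv r theta (theta + pi) (2 * pi) true)//; [|lra|]; last first.
    move=> t t0 tt; rewrite expr1 mulN1r oppr_ge0.
    have -> : t - theta = (t - theta - 2 * pi) + 2 * pi by ring.
    by rewrite mulr_natl sinD2pi -mulr_natl sin_le0_Npi//; lra.
  rewrite sub0r subrr log_denN (addrC theta) addrK (addrC (2 * pi)) log_denD2pi log_denN.
  by ring.
- rewrite (split3 (theta - pi) theta)//; [|lra|lra].
  rewrite (@integral_norm_conj_kernel_itv r theta 0 (theta - pi) false)//; [|lra|]; last first.
    move=> t t0 tt; rewrite expr0 mul1r.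
    by rewrite -sinD2pi -mulr_natl sin_ge0_0pi//; lra.
  rewrite (@integral_norm_conj_kernel_itv r theta (theta - pi) theta true)//; [|lra|]; last first.
    by move=> t t0 tt; rewrite expr1 mulN1r oppr_ge0 sin_le0_Npi//; lra.
  rewrite (@integral_norm_conj_kernel_itv r theta theta (2 * pi) false)//; last first.
    by move=> t t0 tt; rewrite expr0 mul1r sin_ge0_0pi//; lra.
  rewrite (_ : theta - pi - theta = - pi); last by ring.
  rewrite (_ : 0 - theta = - theta); last by ring.
  rewrite (_ : theta - theta = 0); last by ring.
  rewrite (_ : 2 * pi - theta = - theta + 2 * pi); last by ring.
  by rewrite log_denD2pi !log_denN; ring.
Qed.

End kernel.

(** * The radial derivative *)

Section radial_derivative.
Context {R : realType}.
Implicit Types (r s t x y theta : R) (f g u v : R -> R).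
Notation mu := (@lebesgue_measure R).

Lemma abs_continuous_clip_bounded a b f : a <= b -> abs_continuous (f \o clip a b) ->
  exists2 C : R, 0 < C & forall x, `|f (clip a b x)| <= C.
Proof.
move=> ab /abs_continuous_continuous cf.
have cnf : continuous (fun x => `|(f \o clip a b) x|).
  by move=> x; apply: cvg_norm; exact: cf.
have [c _ cP] := EVT_max ab (continuous_subspaceT cnf).
exists (`|(f \o clip a b) c| + 1); first by rewrite ltr_wpDl.
move=> x; have := cP (clip a b x); rewrite in_itv/= clip_itv// => /(_ isT).
by rewrite clip_idem// => h; rewrite (le_trans h)// lerDl.
Qed.

Lemma integrable_mul_bounded (D : set (measurableTypeR R)) f g (C : R) : measurable D ->
  measurable_fun D f -> (forall t, `|f t| <= C) -> mu.-integrable D (EFin \o g) ->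
  mu.-integrable D (EFin \o (fun t => f t * g t)).
Proof.
move=> mD mf fC ig; apply: (integrableMr mD mf _ ig).
exists C; split; first exact: num_real.
by move=> M CM t _ /=; exact: le_trans (fC t) (ltW CM).
Qed.

Lemma measurable_continuous (D : set (measurableTypeR R)) f : continuous f ->
  measurable_fun D f.
Proof. by move=> cf; apply: measurable_funTS; exact: continuous_measurable_fun. Qed.

Lemma continuous_shift_comp f theta : continuous f -> continuous (fun t => f (t - theta)).
Proof.
move=> cf t; apply: (@continuous_comp _ _ _ (fun t => t - theta) f).
  by apply: cvgB; [exact: cvg_id|exact: cvg_cst].
exact: cf.
Qed.

Lemma conj_kernel_le r s : 0 <= r -> r < 1 ->
  `|conj_kernel r s| <= pi^-1 * ((1 - r) ^+ 2)^-1.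
Proof.
move=> r0 r1; rewrite /conj_kernel normrM ger0_norm ?invr_ge0 ?pi_ge0//.
rewrite ler_wpM2l ?invr_ge0 ?pi_ge0// normrM normfV -[leRHS]mul1r.
have d0 := poisson_den_gt0 s r0 r1; rewrite (gtr0_norm d0).
apply: ler_pM => //; first by rewrite invr_ge0 ltW.
  exact: sin_max.
by rewrite lef_pV2 ?posrE ?exprn_gt0 ?subr_gt0// poisson_den_ge.
Qed.

Lemma conj_kernel_lipschitz r theta x y : 0 <= r -> r < 1 -> x <= y ->
  `|conj_kernel r (y - theta) - conj_kernel r (x - theta)| <=
  pi^-1 * (4 / (1 - r) ^+ 4) * (y - x).
Proof.
move=> r0 r1; rewrite le_eqVlt => /predU1P[->|xy].
  by rewrite !subrr normr0 mulr0.
have xy' : x - theta < y - theta by rewrite ltrD2r.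
have dk (z : R) : z \in `](x - theta), (y - theta)[ ->
    is_derive z 1 (conj_kernel r) (conj_kernel' r z).
  by move=> _; exact: is_derive_conj_kernel.
have ck : {within `[(x - theta), (y - theta)], continuous (conj_kernel r)}.
  by apply: continuous_subspaceT; exact: continuous_conj_kernel.
have [c _ ->] := MVT xy' dk ck.
rewrite (_ : y - theta - (x - theta) = y - x); last by ring.
have yx0 : 0 <= y - x by rewrite subr_ge0 ltW.
by rewrite normrM (ger0_norm yx0) ler_wpM2r ?conj_kernel'_le.
Qed.

Lemma abs_continuous_conj_kernel r theta : 0 <= r -> r < 1 ->
  abs_continuous (fun t => conj_kernel r (t - theta)).
Proof.
move=> r0 r1; apply: (@lipschitz_abs_continuous _ _ (pi^-1 * (4 / (1 - r) ^+ 4))).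
  by rewrite mulr_gt0 ?invr_gt0 ?pi_gt0// divr_gt0 ?exprn_gt0 ?subr_gt0.
by move=> x y; exact: conj_kernel_lipschitz.
Qed.

Notation clip2pi := (clip (0 : R) (2 * pi)).

Let pi20 : 0 <= 2 * pi :> R.
Proof. by rewrite mulr_ge0// pi_ge0. Qed.

Let pi2 : 0 < 2 * pi :> R.
Proof. by rewrite mulr_gt0// pi_gt0. Qed.

(** Differentiation under the integral sign. Clipping [u] changes nothing on the segment and makes
    the integrand continuous in [t] on the line. *)
Lemma w_r_re_integral u r theta : 0 < r -> r < 1 -> abs_continuous (u \o clip2pi) ->
  w_r_re u r theta =
  \int[mu]_(t in `[0, 2 * pi]) (conj_kernel' r (t - theta) * u (clip2pi t)).
Proof.
move=> r0 r1 hu.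
have cu : continuous (u \o clip2pi) := abs_continuous_continuous hu.
have [C C0 uC] := abs_continuous_clip_bounded pi20 hu.
rewrite /w_r_re.
have -> : (fun rho => poisson_int u rho theta) = (fun rho => \int[mu]_(t in `[0, 2 * pi])
    (poisson_kernel rho (t - theta) * u (clip2pi t))).
  apply/funext => rho; rewrite /poisson_int; apply: eq_Rintegral => t.
  by rewrite inE/= in_itv/= => /andP[t0 t1]; rewrite clip_id.
(* A radius strictly between [r] and 1: for [rho < r'] the bound on the kernel's derivative taken at
   [r'] dominates. *)
pose r' := (1 + r) / 2.
have r'1 : r' < 1 by rewrite /r'; lra.
have rr' : r < r' by rewrite /r'; lra.
pose f rho t := poisson_kernel rho (t - theta) * u (clip2pi t).
have df (rho t : R) : 0 <= rho -> rho < 1 ->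
    is_derive rho 1 (f ^~ t) (conj_kernel' rho (t - theta) * u (clip2pi t)).
  move=> h0 h1; have dP := is_derive_poisson_kernel (t - theta) h0 h1.
  rewrite /f; apply: is_derive_eq.
  by rewrite /GRing.scale/=; ring.
have pE (rho t : R) : 0 <= rho -> rho < 1 -> partial1of2 f rho t =
    conj_kernel' rho (t - theta) * u (clip2pi t).
  by move=> h0 h1; rewrite partial1of2E; have [] := df rho t h0 h1.
have -> := @differentiation_under_integral R _ _ mu f `[0, 2 * pi]
  (measurable_itv _) r 0 r' _ _ _ (fun=> pi^-1 * (4 / (1 - r') ^+ 4) * C).
- by apply: eq_Rintegral => t _; rewrite pE// ltW.
- by rewrite /= in_itv/= r0 rr'.
- move=> rho; rewrite /= in_itv/= => /andP[h0 h1].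
  apply: continuous_compact_integrable; first exact: segment_compact.
  apply: continuous_subspaceT => t; apply: cvgM; last exact: cu.
  apply: (@continuous_shift_comp (poisson_kernel rho)) => s.
  have -> : poisson_kernel rho = (fun s => (2 * pi)^-1 * ((1 - rho ^+ 2) * (poisson_den rho s)^-1)) by [].
  apply: cvgM; first exact: cvg_cst.
  apply: cvgM; first exact: cvg_cst.
  have h1' := lt_trans h1 r'1.
  apply: cvgV; first by rewrite poisson_den_neq0// ltW.
  apply: differentiable_continuous; apply/derivable1_diffP.
  by have [] := is_derive_poisson_den_angle rho s.
- move=> rho t; rewrite /= in_itv/= => /andP[h0 h1] _.
  by have [] := df rho t (ltW h0) (lt_trans h1 r'1).
- move=> t; rewrite !mulr_ge0 ?invr_ge0 ?pi_ge0 ?exprn_ge0 ?subr_ge0 ?(ltW C0) ?(ltW r'1)//.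
- apply: continuous_compact_integrable; first exact: segment_compact.
  by apply: continuous_subspaceT => t; exact: cvg_cst.
- move=> rho t; rewrite /= in_itv/= => /andP[h0 h1] _.
  rewrite pE ?(ltW h0) ?(lt_trans h1 r'1)// normrM; apply: ler_pM => //.
  apply: le_trans (conj_kernel'_le _ (ltW h0) (lt_trans h1 r'1)) _.
  rewrite ler_wpM2l ?invr_ge0 ?pi_ge0// ler_wpM2l//.
  rewrite lef_pV2 ?posrE ?exprn_gt0 ?subr_gt0// ?(lt_trans h1 r'1)//.
  by rewrite lerXn2r// ?nnegrE; lra.
Qed.

(** The derivative agrees almost everywhere with an integrable density; the endpoints are null. *)
Lemma integrable_derive1 u : abs_continuous (u \o clip2pi) ->
  measurable_fun `[0, 2 * pi] (derive1 u) ->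
  mu.-integrable `[0, 2 * pi] (EFin \o derive1 u).
Proof.
move=> hu mdu; have [g ig [gE _]] := abs_continuous_FTC pi2 hu.
apply: (integrable_ae_eq _ ig mdu); first exact: measurable_itv.
have := ae_itv_oo_cc gE.
apply: filterS; first exact: (ae_filter_ringOfSetsType mu).
by move=> x H xab; have [] := H xab.
Qed.

Lemma w_r_re_conj_kernel u r theta : 0 < r -> r < 1 -> abs_continuous (u \o clip2pi) ->
  u 0 = u (2 * pi) -> measurable_fun `[0, 2 * pi] (derive1 u) ->
  w_r_re u r theta =
  - \int[mu]_(t in `[0, 2 * pi]) (conj_kernel r (t - theta) * derive1 u t).
Proof.
move=> r0 r1 hu u02 mdu; rewrite w_r_re_integral//.
have cu : continuous (u \o clip2pi) := abs_continuous_continuous hu.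
have [C C0 uC] := abs_continuous_clip_bounded pi20 hu.
have ck := @continuous_shift_comp _ theta (continuous_conj_kernel (ltW r0) r1).
have ck' := @continuous_shift_comp _ theta (continuous_conj_kernel' (ltW r0) r1).
(* The product lemma wants one bound for both factors; the sum of the two bounds is one. *)
pose B : R := C + pi^-1 * ((1 - r) ^+ 2)^-1.
have B0 : 0 < B.
  by rewrite ltr_pwDl// mulr_ge0 ?invr_ge0 ?pi_ge0 ?sqr_ge0.
have hku : abs_continuous ((fun t => conj_kernel r (t - theta) * u t) \o clip2pi).
  apply: (@abs_continuousM _ ((fun t => conj_kernel r (t - theta)) \o clip2pi) _ B) => //.
  - move=> x; apply: le_trans (conj_kernel_le _ (ltW r0) r1) _.
    by rewrite lerDr ltW.
  - move=> x; apply: le_trans (uC x) _.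
    by rewrite lerDl mulr_ge0 ?invr_ge0 ?pi_ge0 ?sqr_ge0.
  - by apply: abs_continuous_comp_clip => //; apply: abs_continuous_conj_kernel => //; exact: ltW.
have [gu igu [guE _]] := abs_continuous_FTC pi2 hu.
have [gh igh [ghE ghI]] := abs_continuous_FTC pi2 hku.
have mI : measurable (`[0, 2 * pi]%classic : set (measurableTypeR R)) by exact: measurable_itv.
have i1 : mu.-integrable `[0, 2 * pi]
    (EFin \o (fun t => conj_kernel' r (t - theta) * u (clip2pi t))).
  apply: continuous_compact_integrable; first exact: segment_compact.
  by apply: continuous_subspaceT => t; apply: cvgM; [exact: ck'|exact: cu].
have i2 : mu.-integrable `[0, 2 * pi]
    (EFin \o (fun t => conj_kernel r (t - theta) * derive1 u t)).
  apply: (@integrable_mul_bounded _ _ _ (pi^-1 * ((1 - r) ^+ 2)^-1)) => //.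
  - exact: measurable_continuous.
  - by move=> t; exact: conj_kernel_le (ltW r0) r1.
  - exact: integrable_derive1.
(* It remains that $\int(K'u+Ku')=0$. The integrand is almost everywhere the derivative of $Ku$, and
   the boundary terms cancel because $K$ and $u$ take equal values at [0] and [2 * pi]. *)
apply/eqP; rewrite -addr_eq0 -RintegralD//; apply/eqP.
transitivity (\int[mu]_(t in `[0, 2 * pi]) gh t); last first.
  rewrite ghI -u02 -[2 * pi]add0r addrAC conj_kernelD2pi sub0r.
  by rewrite subrr.
apply: Rintegral_ae_eq => //.
- apply: measurable_funD.
    by case/integrableP : i1 => /measurable_EFinP.
  by case/integrableP : i2 => /measurable_EFinP.
- by case/integrableP : igh => /measurable_EFinP.
have H1 := ae_itv_oo_cc guE; have H2 := ae_itv_oo_cc ghE.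
apply: filterS2 H1 H2; first exact: (ae_filter_ringOfSetsType mu).
move=> t H1 H2 tI; have [du _] := H1 tI; have [_ <-] := H2 tI.
have du' : is_derive t 1 u (derive1 u t) by apply: DeriveDef; rewrite ?derive1E.
have dk := is_derive_conj_kernel (t - theta) (ltW r0) r1.
have dB : is_derive t (1 : R) (fun t => t - theta) 1.
  by apply: is_derive_eq; rewrite subr0.
have dC := @is_derive1_comp _ (conj_kernel r) (fun t => t - theta) _ _ _ dk dB.
have dM : is_derive t 1 (fun t => conj_kernel r (t - theta) * u t)
    (conj_kernel' r (t - theta) * u t + conj_kernel r (t - theta) * derive1 u t).
  have -> : (fun t => conj_kernel r (t - theta) * u t) =
     (fun t => (conj_kernel r \o (fun t => t - theta)) t * u t) by [].
  by apply: is_derive_eq; rewrite /GRing.scale/=; ring.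
rewrite [RHS]derive1E; have [_ ->] := dM.
by move: tI; rewrite /= in_itv/= => /andP[t0 t1]; rewrite clip_id.
Qed.

(** Cauchy-Schwarz in the plane, by Lagrange's identity. *)
Lemma cmod_dot x y s t : `|x * s + y * t| <= cmod x y * cmod s t.
Proof.
rewrite /cmod -sqrtrM ?addr_ge0 ?sqr_ge0// -sqrtr_sqr ler_sqrt.
  rewrite -subr_ge0 (_ : _ - _ = (x * t - y * s) ^+ 2) ?sqr_ge0//; ring.
by rewrite mulr_ge0// addr_ge0 ?sqr_ge0.
Qed.

Lemma cmod_ge0 x y : 0 <= cmod x y.
Proof. exact: sqrtr_ge0. Qed.

Lemma cmod_sqr x y : cmod x y ^+ 2 = x ^+ 2 + y ^+ 2.
Proof. by rewrite sqr_sqrtr// addr_ge0 ?sqr_ge0. Qed.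

Lemma cmod_le_norm x y : cmod x y <= `|x| + `|y|.
Proof.
rewrite -ler_sqr ?nnegrE ?cmod_ge0 ?addr_ge0// cmod_sqr sqrrD !real_normK ?num_real//.
by rewrite addrAC lerDl mulrn_wge0// mulr_ge0.
Qed.

Lemma measurable_cmod d (T : measurableType d) (D : set T) (h k : T -> R) : measurable_fun D h ->
  measurable_fun D k -> measurable_fun D (fun z => cmod (h z) (k z)).
Proof.
move=> mh mk; apply: measurableT_comp.
  exact: (measurable_continuous (@sqrt_continuous R)).
by apply: measurable_funD; exact: measurable_funX.
Qed.

(** Triangle inequality for a plane-valued integral. With $w_r=(A,B)$, pairing $w_r$ with itself
    gives $A^2+B^2=-\int K(Au'+Bv')\le|w_r|\int|K||F'|$ by Cauchy-Schwarz, and one factor $|w_r|$ is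
    cancelled. *)
Lemma abs_w_r_le u v r theta : 0 < r -> r < 1 ->
  abs_continuous (u \o clip2pi) -> abs_continuous (v \o clip2pi) ->
  u 0 = u (2 * pi) -> v 0 = v (2 * pi) ->
  measurable_fun `[0, 2 * pi] (derive1 u) -> measurable_fun `[0, 2 * pi] (derive1 v) ->
  mu.-integrable `[0, 2 * pi] (EFin \o abs_Fdot u v) /\
  abs_w_r u v r theta <=
  \int[mu]_(t in `[0, 2 * pi]) (`|conj_kernel r (t - theta)| * abs_Fdot u v t).
Proof.
move=> r0 r1 hu hv u02 v02 mdu mdv.
have mI : measurable (`[0, 2 * pi]%classic : set (measurableTypeR R)) by exact: measurable_itv.
have iu := integrable_derive1 hu mdu; have iv := integrable_derive1 hv mdv.
have mF : measurable_fun `[0, 2 * pi] (abs_Fdot u v) by exact: measurable_cmod.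
have iF : mu.-integrable `[0, 2 * pi] (EFin \o abs_Fdot u v).
  apply: (le_integrable mI _ _ (integrableD mI (integrable_abse iu) (integrable_abse iv))).
    exact/measurable_EFinP.
  move=> t _ /=; rewrite lee_fin ger0_norm ?cmod_ge0// ger0_norm ?addr_ge0//.
  exact: cmod_le_norm.
split => //.
have ck := @continuous_shift_comp _ theta (continuous_conj_kernel (ltW r0) r1).
have iK g : mu.-integrable `[0, 2 * pi] (EFin \o g) ->
    mu.-integrable `[0, 2 * pi] (EFin \o (fun t => conj_kernel r (t - theta) * g t)).
  apply: (@integrable_mul_bounded _ _ _ (pi^-1 * ((1 - r) ^+ 2)^-1)) => //.
    exact: measurable_continuous.
  by move=> t; exact: conj_kernel_le (ltW r0) r1.
have iKn : mu.-integrable `[0, 2 * pi]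
    (EFin \o (fun t => `|conj_kernel r (t - theta)| * abs_Fdot u v t)).
  apply: (@integrable_mul_bounded _ _ _ (pi^-1 * ((1 - r) ^+ 2)^-1)) => //.
    by apply: measurableT_comp => //; exact: measurable_continuous.
  by move=> t; rewrite normr_id; exact: conj_kernel_le (ltW r0) r1.
set I := \int[mu]_(t in _) _.
have I0 : 0 <= I by apply: Rintegral_ge0 => // t _; rewrite mulr_ge0// cmod_ge0.
have iA := iK _ iu; have iB := iK _ iv.
have eA : \int[mu]_(t in `[0, 2 * pi]) (conj_kernel r (t - theta) * derive1 u t) =
    - w_r_re u r theta by rewrite w_r_re_conj_kernel// opprK.
have eB : \int[mu]_(t in `[0, 2 * pi]) (conj_kernel r (t - theta) * derive1 v t) =
    - w_r_re v r theta by rewrite w_r_re_conj_kernel// opprK.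
move: eA eB; rewrite /abs_w_r; move: (w_r_re u r theta) (w_r_re v r theta) => A B eA eB.
have [c0|] := leP (cmod A B) 0; first exact: le_trans c0 I0.
move=> c0; rewrite -(ler_pM2l c0) -expr2 cmod_sqr.
have zA := RintegralZl (- A) mI iA; have zB := RintegralZl (- B) mI iB.
have zI := RintegralZl (cmod A B) mI iKn.
have iZA : mu.-integrable `[0, 2 * pi]
    (EFin \o (fun t => - A * (conj_kernel r (t - theta) * derive1 u t))).
  exact: (integrableZl mI (- A) iA).
have iZB : mu.-integrable `[0, 2 * pi]
    (EFin \o (fun t => - B * (conj_kernel r (t - theta) * derive1 v t))).
  exact: (integrableZl mI (- B) iB).
have -> : A ^+ 2 + B ^+ 2 = \int[mu]_(t in `[0, 2 * pi])
    (- A * (conj_kernel r (t - theta) * derive1 u t) +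
     - B * (conj_kernel r (t - theta) * derive1 v t)).
  by rewrite (RintegralD mI iZA iZB) zA zB eA eB !mulrNN !expr2.
rewrite /I -zI; apply: le_Rintegral => //.
- exact: (integrableD mI iZA iZB).
- exact: (integrableZl mI (cmod A B) iKn).
move=> t _; rewrite (le_trans (ler_norm _))//.
rewrite (_ : _ + _ = - (conj_kernel r (t - theta) * (A * derive1 u t + B * derive1 v t))); last by ring.
rewrite normrN normrM mulrCA ler_wpM2l//; exact: cmod_dot.
Qed.

End radial_derivative.

(** * Jensen's inequality and the constant C(p) *)

Section jensen.
Context {R : realType}.
Implicit Types (p m x y : R).
Notation mu := (@lebesgue_measure R).

(** Young's inequality for the product of [y] and 1. The case [p = 1] is apart, its conjugate
    exponent being infinite. *)
Lemma bernoulli_powR p y : 1 <= p -> 0 <= y -> 1 + p * (y - 1) <= y `^ p.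
Proof.
rewrite le_eqVlt => /predU1P[<-|p1] y0; first by rewrite powRr1// mul1r addrC subrK.
have p0 : 0 < p by exact: lt_trans ltr01 p1.
have q0 : 0 < (1 - p^-1)^-1 by rewrite invr_gt0 subr_gt0 invf_lt1.
have pq : p^-1 + (1 - p^-1)^-1^-1 = 1 by rewrite invrK addrC subrK.
have := conjugate_powR y0 ler01 p0 q0 pq.
rewrite mulr1 powR1 invrK mul1r -lerBlDr ler_pdivlMr//.
by rewrite (_ : (y - (1 - p^-1)) * p = 1 + p * (y - 1))//; field; rewrite gt_eqF.
Qed.

Lemma powR_tangent p m x : 1 <= p -> 0 < m -> 0 <= x ->
  m `^ p + p * (m `^ p / m) * (x - m) <= x `^ p.
Proof.
move=> p1 m0 x0; have m0' : m != 0 by rewrite gt_eqF.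
have xm0 : 0 <= x / m by rewrite divr_ge0// ltW.
have := bernoulli_powR p1 xm0; rewrite -(ler_pM2l (powR_gt0 p m0)).
rewrite -powRM ?(ltW m0)// (mulrC m) divfK//; apply: le_trans.
by rewrite le_eqVlt; apply/orP; left; apply/eqP; field.
Qed.

(** The tangent of $x^p$ at the weighted mean [m] lies below the curve; integrated against [k], its
    linear term vanishes. The weight has mass [M] instead of 1, which produces the power [p - 1]. A
    zero mean is treated apart, because the tangent needs [0 < m]. *)
Lemma jensen_powR (D : set (measurableTypeR R)) p (k f : R -> R) : measurable D -> 1 <= p ->
  (forall t, 0 <= k t) -> (forall t, 0 <= f t) ->
  mu.-integrable D (EFin \o k) ->
  mu.-integrable D (EFin \o (fun t => k t * f t)) ->
  mu.-integrable D (EFin \o (fun t => k t * f t `^ p)) ->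
  0 < \int[mu]_(t in D) k t ->
  (\int[mu]_(t in D) (k t * f t)) `^ p <=
  (\int[mu]_(t in D) k t) `^ (p - 1) * \int[mu]_(t in D) (k t * f t `^ p).
Proof.
move=> mD p1 k0 f0 ik ikf ikfp M0.
set M := \int[mu]_(t in D) k t in M0 *; set I := \int[mu]_(t in D) (k t * f t).
have p0 : 0 < p by exact: lt_le_trans ltr01 p1.
have I0 : 0 <= I by apply: Rintegral_ge0 => t _; rewrite mulr_ge0.
move: I0; rewrite le_eqVlt => /predU1P[<-|I0].
  rewrite powR0 ?gt_eqF// mulr_ge0 ?powR_ge0//.
  by apply: Rintegral_ge0 => t _; rewrite mulr_ge0 ?powR_ge0.
have [m mE] : exists m, m = I / M by exists (I / M).
have m0 : 0 < m by rewrite mE divr_gt0.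
have IE : I = M * m by rewrite mE mulrC divfK// gt_eqF.
rewrite IE powRM ?(ltW M0)// ?(ltW m0)//.
have -> : M `^ p = M `^ (p - 1) * M.
  have -> : M `^ p = M `^ ((p - 1) + 1) by rewrite subrK.
  rewrite powRD ?powRr1 ?(ltW M0)//.
  by apply/implyP => _; rewrite gt_eqF.
rewrite -mulrA ler_wpM2l ?powR_ge0//.
pose c := p * (m `^ p / m).
have i1 := integrableZl mD (m `^ p - c * m) ik.
have i2 := integrableZl mD c ikf.
have : \int[mu]_(t in D) ((m `^ p - c * m) * k t + c * (k t * f t)) <=
    \int[mu]_(t in D) (k t * f t `^ p).
  apply: (le_Rintegral mD (integrableD mD i1 i2) ikfp) => t _.
  have := powR_tangent p1 m0 (f0 t); rewrite -/c => /(ler_wpM2l (k0 t)).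
  by apply: le_trans; rewrite le_eqVlt; apply/orP; left; apply/eqP; ring.
apply: le_trans; rewrite (RintegralD mD i1 i2).
rewrite (RintegralZl (m `^ p - c * m) mD ik) (RintegralZl c mD ikf).
rewrite -/M -/I IE.
by rewrite le_eqVlt; apply/orP; left; apply/eqP; ring.
Qed.

End jensen.

(** * Finiteness of $C(p)$ *)

Section Cp_finite.
Context {R : realType}.
Implicit Types (p r x y : R).
Notation mu := (@lebesgue_measure R).

Lemma atanh_gt0 r : 0 < r -> r < 1 -> 0 < atanh r.
Proof.
move=> r0 r1; rewrite /atanh mulr_gt0 ?invr_gt0// ln_gt0//.
by rewrite ltr_pdivlMr ?subr_gt0//; lra.
Qed.

(* With [y = (1 - r)^-a >= 1], [- ln (1 - r) = ln y / a <= (y - 1) / a], and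
   [y - 1 <= r y] because [(1 - r)^a >= 1 - r]. *)
Lemma atanh_le (a r : R) : 0 < a -> a <= 1 -> 0 < r -> r < 1 ->
  atanh r / r <= (1 + a^-1) / 2 * (1 - r) `^ (- a).
Proof.
move=> a0 a1 r0 r1; rewrite ler_pdivrMr//.
have s0 : 0 < 1 - r by rewrite subr_gt0.
have s1 : 1 - r <= 1 by lra.
have s2 : 0 < 1 + r by rewrite addr_gt0.
rewrite /atanh ln_div ?posrE//.
have l1 : ln (1 + r) <= r by apply: le_ln1Dx; lra.
set y := (1 - r) `^ (- a).
have y0 : 0 < y by exact: powR_gt0.
have ya : y * (1 - r) `^ a = 1 by rewrite /y powRN mulVf// gt_eqF// powR_gt0.
have ra : 1 - r <= (1 - r) `^ a.
  have l0 : ln (1 - r) <= 0 by exact: ln_le0.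
  have sn0 : 1 - r != 0 by rewrite gt_eqF.
  rewrite -[leLHS]lnK ?posrE// /powR (negbTE sn0) ler_expR -subr_ge0.
  by rewrite (_ : _ - _ = (1 - a) * (- ln (1 - r))) ?mulr_ge0 ?subr_ge0 ?oppr_ge0//; ring.
have yr : y - 1 <= r * y.
  by rewrite lerBlDr -[in X in _ + X]ya (mulrC r) -mulrDr ler_pMr// ; lra.
have y1 : 1 <= y.
  rewrite -[leLHS]ya ger_pMr//.
  apply: (@le_trans _ _ (1 `^ a)); last by rewrite powR1.
  by apply: ge0_ler_powR; rewrite ?nnegrE ?(ltW a0) ?(ltW s0).
have l2 : - ln (1 - r) <= a^-1 * (r * y).
  have -> : - ln (1 - r) = a^-1 * ln y by rewrite /y ln_powR; field; rewrite gt_eqF.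
  rewrite ler_wpM2l ?invr_ge0 ?(ltW a0)//; apply: le_trans yr.
  rewrite [y in ln y](_ : y = 1 + (y - 1)); last by ring.
  by apply: le_ln1Dx; lra.
have ry : r <= r * y by rewrite ler_pMr.
rewrite (_ : _ * y * r = 2^-1 * (r * y + a^-1 * (r * y))); last by field; rewrite gt_eqF.
by rewrite ler_wpM2l ?invr_ge0//; lra.
Qed.

Lemma is_derive_expR_ln1B (b r : R) : 0 < 1 - r ->
  is_derive r 1 (fun r => expR (b * ln (1 - r)))
    (expR (b * ln (1 - r)) * (b * ((1 - r)^-1 * -1))).
Proof.
move=> r1; have dB : is_derive r (1 : R) (fun r => 1 - r) (-1).
  by apply: is_derive_eq; rewrite ?sub0r ?add0r /GRing.scale/=; ring.
have dL := @is_derive1_comp _ (@ln R) (fun r => 1 - r) _ _ _ (is_derive1_ln r1) dB.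
have dM : is_derive r (1 : R) (fun r => b * (@ln R \o (fun r => 1 - r)) r)
    (b * ((1 - r)^-1 * -1)).
  by apply: is_derive_eq.
exact: (@is_derive1_comp _ (@expR R)
  (fun r => b * (@ln R \o (fun r => 1 - r)) r) _ _ _ (is_derive_expR _) dM).
Qed.

Lemma measurable_inv_sqrt1B (D : set (measurableTypeR R)) :
  measurable_fun D (fun r => ((1 - r) `^ (- 2^-1))%:E).
Proof.
apply: measurable_funTS; apply/measurable_EFinP.
apply: (measurableT_comp (measurable_powR (- 2^-1))).
exact: measurable_funB.
Qed.

(** The segments $[0,1-1/(n+1)]$ stay away from the singularity at 1; on each, the primitive
    $-2\sqrt{1-r}$ bounds the integral by 2, and monotone convergence concludes. *)
Lemma integral_inv_sqrt_lty :
  (\int[mu]_(r in `]0%R, 1%R[) ((1 - r) `^ (- 2^-1))%:E < +oo)%E.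
Proof.
pose F (n : nat) : set (measurableTypeR R) := `[0, 1 - n.+1%:R^-1]%classic.
have ndF : {homo F : n m / (n <= m)%N >-> (n <= m)%O}.
  move=> n m nm; apply/subsetPset; apply: subset_itvl; rewrite bnd_simp lerD2l lerN2.
  by rewrite lef_pV2 ?posrE ?ltr0n// ler_nat.
have mF n : measurable (F n : set (measurableTypeR R)) by exact: measurable_itv.
have f0 (D : set R) r : D r -> (0 <= ((1 - r) `^ (- 2^-1))%:E)%E.
  by move=> _; rewrite lee_fin powR_ge0.
have cvF := @ge0_nondecreasing_set_cvg_integral _ _ _ F _ mu ndF mF
  (fun n => @measurable_inv_sqrt1B (F n)) (fun n => @f0 (F n)).
apply: (@le_lt_trans _ _ 2%:E); last exact: ltry.
apply: (@le_trans _ _ (\int[mu]_(r in \bigcup_n F n) ((1 - r) `^ (- 2^-1))%:E)%E).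
  apply: ge0_subset_integral.
  - exact: measurable_itv.
  - exact: bigcup_measurable.
  - exact: measurable_inv_sqrt1B.
  - exact: f0.
  move=> r /=; rewrite in_itv/= => /andP[r0 r1].
  exists (Num.bound (1 - r)^-1) => //; rewrite /F/= in_itv/= (ltW r0)/=.
  rewrite lerBrDl -lerBrDr -[leRHS]invrK lef_pV2 ?posrE ?invr_gt0 ?subr_gt0//.
  apply: le_trans (ltW (archi_boundP _)) _; first by rewrite invr_ge0 subr_ge0 ltW.
  by rewrite ler_nat.
rewrite -(cvg_lim _ cvF)//; apply: lime_le; first exact: cvgP cvF.
apply: nearW => n.
(* For [n = 0] the segment is a point, to which the fundamental theorem does not apply. *)
have [->|n0] := eqVneq n 0%N.
  by rewrite /F invr1 subrr set_itv1 integral_set1 lee_fin.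
have N1 : 0 < 1 - n.+1%:R^-1 :> R.
  by rewrite subr_gt0 invf_lt1 ?ltr0n// ltr1n ltnS lt0n.
have pos r : 0 <= r -> r <= 1 - n.+1%:R^-1 -> 0 < 1 - r.
  move=> _ rn; rewrite subr_gt0; apply: le_lt_trans rn _.
  by rewrite ltrBlDr ltrDl invr_gt0 ltr0n.
have -> : (\int[mu]_(r in F n) ((1 - r) `^ (- 2^-1))%:E =
    \int[mu]_(r in F n) (expR (- 2^-1 * ln (1 - r)))%:E)%E.
  apply: eq_integral => r; rewrite inE /F/= in_itv/= => /andP[r0 rn].
  by rewrite /powR gt_eqF// pos.
(* This is $-2\sqrt{1-r}$ in a form that the derivatives of [expR] and [ln] can treat. *)
pose G (r : R) : R := - 2 * expR (2^-1 * ln (1 - r)).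
have dG r : 0 < 1 - r -> is_derive r 1 G (expR (- 2^-1 * ln (1 - r))).
  move=> r1; have dE := is_derive_expR_ln1B 2^-1 r1.
  rewrite /G; apply: is_derive_eq; rewrite /GRing.scale/=.
  have -> : - 2^-1 * ln (1 - r) = 2^-1 * ln (1 - r) - ln (1 - r) by lra.
  rewrite expRD expRN lnK ?posrE//.
  have rn0 : 1 - r != 0 by rewrite gt_eqF.
  by field.
have cG r : 0 < 1 - r -> {for r, continuous G}.
  move=> r1; apply: differentiable_continuous; apply/derivable1_diffP.
  by have [] := dG r r1.
have cf r : 0 < 1 - r -> {for r, continuous (fun r => expR (- 2^-1 * ln (1 - r)))}.
  move=> r1; apply: differentiable_continuous; apply/derivable1_diffP.
  by have [] := is_derive_expR_ln1B (- 2^-1) r1.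
rewrite (@continuous_FTC2 _ (fun r => expR (- 2^-1 * ln (1 - r))) G)//.
- rewrite -EFinB lee_fin /G subr0 ln1 mulr0 expR0.
  have := expR_ge0 (2^-1 * ln (1 - (1 - n.+1%:R^-1)) : R); lra.
- apply: continuous_in_subspaceT => r; rewrite inE/= in_itv/= => /andP[r0 rn].
  exact/cf/pos.
- split.
  + by move=> r; rewrite in_itv/= => /andP[r0 rn]; have [] := dG r (pos r (ltW r0) (ltW rn)).
  + by apply: cvg_at_right_filter; apply: cG; rewrite subr0.
  + by apply: cvg_at_left_filter; apply: cG; apply: pos => //; exact: ltW.
- move=> r; rewrite in_itv/= => /andP[r0 rn]; rewrite derive1E.
  by have [] := dG r (pos r (ltW r0) (ltW rn)).
Qed.

Lemma measurable_inv_atanh :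
  measurable_fun (`]0, 1[ : set (measurableTypeR R)) (fun r => 4 * atanh r / (pi * r)).
Proof.
apply: (@eq_measurable_fun _ _ _ _ _
  (fun r => 4 * (2^-1 * (ln (1 + r) - ln (1 - r))) * (pi * r) `^ (- 1))).
  move=> r; rewrite inE/= in_itv/= => /andP[r0 r1].
  rewrite powR_inv1; last by rewrite mulr_ge0 ?pi_ge0 ?ltW.
  by rewrite /atanh ln_div ?posrE ?subr_gt0// addr_gt0.
apply: measurable_funTS; apply: measurable_funM; last first.
  by apply: (measurableT_comp (measurable_powR (- 1))); exact: measurable_funM.
apply: measurable_funM => //; apply: measurable_funM => //; apply: measurable_funB.
  by apply: (measurableT_comp (@measurable_ln R)); exact: measurable_funD.
by apply: (measurableT_comp (@measurable_ln R)); exact: measurable_funB.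
Qed.

Lemma measurable_Cp_integrand p :
  measurable_fun (`]0, 1[ : set (measurableTypeR R))
    (fun r => ((4 * atanh r / (pi * r)) `^ p * r)%:E).
Proof.
apply/measurable_EFinP; apply: measurable_funM => //.
by apply: (measurableT_comp (measurable_powR p)); exact: measurable_inv_atanh.
Qed.

Lemma Cp_lty p : 1 <= p -> (Cp p < +oo)%E.
Proof.
move=> p1; have p0 : 0 < p by exact: lt_le_trans ltr01 p1.
pose a : R := (2 * p)^-1.
have a0 : 0 < a by rewrite invr_gt0 mulr_gt0.
have a1 : a <= 1 by rewrite invf_le1 ?mulr_gt0//; lra.
pose c : R := 4 / pi * ((1 + a^-1) / 2).
have c0 : 0 <= c.
  have ai : 0 < a^-1 by rewrite invr_gt0.
  by rewrite mulr_ge0 ?divr_ge0 ?pi_ge0//; lra.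
apply: (@le_lt_trans _ _ ((c `^ p)%:E * \int[mu]_(r in `]0%R, 1%R[) ((1 - r) `^ (- 2^-1))%:E)%E); last first.
  by rewrite lte_mul_pinfty ?integral_inv_sqrt_lty ?lee_fin ?powR_ge0.
rewrite -ge0_integralZl_EFin ?powR_ge0//; last 2 first.
- by move=> r _; rewrite lee_fin powR_ge0.
- exact: measurable_inv_sqrt1B.
apply: ge0_le_integral.
- exact: measurable_itv.
- by move=> r /=; rewrite in_itv/= => /andP[r0 _]; rewrite lee_fin mulr_ge0 ?powR_ge0 ?ltW.
- exact: measurable_Cp_integrand.
- by apply: measurable_funeM; exact: measurable_inv_sqrt1B.
move=> r /=; rewrite in_itv/= => /andP[r0 r1].
rewrite -EFinM lee_fin -[leRHS]mulr1; apply: ler_pM; rewrite ?powR_ge0 ?(ltW r0) ?(ltW r1)//.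
have -> : - 2^-1 = - a * p :> R by rewrite /a; field; rewrite gt_eqF.
rewrite powRrM -powRM ?powR_ge0//.
have rn0 : r != 0 by rewrite gt_eqF.
have -> : 4 * atanh r / (pi * r) = 4 / pi * (atanh r / r).
  by have := @pi_neq0 R; move: (@pi R) => q pn0; field; rewrite pn0 rn0.
apply: ge0_ler_powR; rewrite ?nnegrE ?(ltW p0)//.
- by rewrite mulr_ge0 ?divr_ge0 ?pi_ge0 ?(ltW r0) ?(ltW (atanh_gt0 r0 r1)).
- by rewrite mulr_ge0 ?powR_ge0.
rewrite /c -[leRHS]mulrA ler_wpM2l ?divr_ge0 ?pi_ge0//.
exact: atanh_le.
Qed.

End Cp_finite.

(** * The Bergman norm *)

Section bergman.
Context {R : realType}.
Implicit Types (p r t theta : R) (u v : R -> R).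
Notation mu := (@lebesgue_measure R).
Notation RT := (measurableTypeR R).
Notation clip2pi := (clip (0 : R) (2 * pi)).
Notation T2pi := (`[0, 2 * pi]%classic : set RT).
Notation J2pi := (`[0, 2 * pi[%classic : set RT).
Notation D2 := (`]0, 1[ `*` `[0, 2 * pi[ : set (RT * RT)).

Let pi20 : 0 <= 2 * pi :> R.
Proof. by rewrite mulr_ge0// pi_ge0. Qed.

Lemma measurable_conj_kernel'_comp d (T : measurableType d) (h k : T -> R) :
  measurable_fun setT h -> measurable_fun setT k ->
  measurable_fun setT (fun z => conj_kernel' (h z) (k z)).
Proof.
move=> mh mk.
have mc : measurable_fun setT (fun z => cos (k z)).
  by apply: measurableT_comp mk; exact: (measurable_continuous (@continuous_cos R)).
have mh2 : measurable_fun setT (fun z => h z ^+ 2) by exact: measurable_funX.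
have m2h : measurable_fun setT (fun z => 2 * h z) by exact: measurable_funM.
rewrite (_ : (fun _ => _) = (fun z => pi^-1 * ((cos (k z) * (1 + h z ^+ 2) - 2 * h z) *
    (poisson_den (h z) (k z) ^+ 2) `^ (- 1)))); last first.
  (* [powR] supplies the measurability of the inverse. *)
  by apply/funext => z; rewrite /conj_kernel' powR_inv1 ?sqr_ge0.
apply: measurable_funM => //; apply: measurable_funM.
  by apply: measurable_funB => //; apply: measurable_funM => //; exact: measurable_funD.
apply: (measurableT_comp (measurable_powR (- 1))); apply: measurable_funX.
apply: measurable_funD => //; apply: measurable_funB => //.
exact: measurable_funM.
Qed.

(** On [D2] the radial derivative is an integral over [t] of a jointly measurable function;
    Tonelli's theorem, applied to the positive and negative parts, gives measurability in the
    parameters. *)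
Lemma measurable_w_r_re u : abs_continuous (u \o clip2pi) ->
  measurable_fun D2 (fun z : RT * RT => w_r_re u z.1 z.2).
Proof.
move=> hu; have cu : continuous (u \o clip2pi) := abs_continuous_continuous hu.
pose H (x : (RT * RT) * RT) : R :=
  conj_kernel' x.1.1 (x.2 - x.1.2) * u (clip2pi x.2) * \1_T2pi x.2.
have mH : measurable_fun setT H.
  apply: measurable_funM.
    apply: measurable_funM.
      apply: (@measurable_conj_kernel'_comp _ _ (fun x : (RT * RT) * RT => x.1.1)
        (fun x => x.2 - x.1.2)).
        exact: (measurableT_comp measurable_fst measurable_fst).
      apply: measurable_funB; first exact: measurable_snd.
      exact: (measurableT_comp measurable_snd measurable_fst).
    by apply: (measurableT_comp (measurable_continuous cu)); exact: measurable_snd.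
  apply: (@measurableT_comp _ _ _ _ _ _ (\1_T2pi : RT -> R)); last exact: measurable_snd.
  by apply: measurable_indic; exact: measurable_itv.
pose W (z : RT * RT) : \bar R :=
  (fubini_F mu ((EFin \o H)^\+)%E z - fubini_F mu ((EFin \o H)^\-)%E z)%E.
have mW : measurable_fun setT W.
  apply: emeasurable_funB.
  - apply: measurable_fun_fubini_tonelli_F.
      by apply: measurable_funepos; exact/measurable_EFinP.
    by move=> x; exact: funepos_ge0.
  - apply: measurable_fun_fubini_tonelli_F.
      by apply: measurable_funeneg; exact/measurable_EFinP.
    by move=> x; exact: funeneg_ge0.
apply: (@eq_measurable_fun _ _ _ _ _ (fun z => fine (W z))).
  move=> [r theta]; rewrite inE => -[] /=; rewrite !in_itv/= => /andP[r0 r1] _.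
  rewrite w_r_re_integral// /Rintegral integral_mkcond integralE /W.
  congr (fine (_ - _)%E).
  - rewrite /fubini_F; apply: eq_integral => t _.
    by rewrite !funeposE patchE /H /= indicE; case: ifP => _; rewrite ?mulr1 ?mulr0.
  - rewrite /fubini_F; apply: eq_integral => t _.
    by rewrite !funenegE patchE /H /= indicE; case: ifP => _; rewrite ?mulr1 ?mulr0.
by apply: measurable_funTS; apply: measurableT_comp mW; exact: fine_measurable.
Qed.

Lemma measurable_abs_w_r u v :
  abs_continuous (u \o clip2pi) -> abs_continuous (v \o clip2pi) ->
  measurable_fun D2 (fun z : RT * RT => abs_w_r u v z.1 z.2).
Proof.
move=> hu hv; rewrite /abs_w_r; apply: measurable_cmod.
  exact: measurable_w_r_re.
exact: measurable_w_r_re.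
Qed.

Lemma measurable_D2 : measurable D2.
Proof. by apply: measurableX; exact: measurable_itv. Qed.

Lemma measurable_abs_w_r_section u v r : 0 < r -> r < 1 ->
  abs_continuous (u \o clip2pi) -> abs_continuous (v \o clip2pi) ->
  measurable_fun J2pi (abs_w_r u v r).
Proof.
move=> r0 r1 hu hv.
pose h (z : RT * RT) := abs_w_r u v z.1 z.2.
have mh : measurable_fun setT (h \_ D2).
  by apply/(measurable_restrictT _ measurable_D2); exact: measurable_abs_w_r.
apply: (@eq_measurable_fun _ _ _ _ _ (fun theta => (h \_ D2) (r, theta))).
  move=> theta; rewrite inE/= => thJ; rewrite patchE mem_set//.
  by split => //=; rewrite in_itv/= r0.
apply: measurable_funTS.
exact: (measurableT_comp mh (pair1_measurable r)).
Qed.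

(** The kernel is odd in the angle, so [t] and [theta] may exchange roles in the norm computed
    above. *)
Lemma eintegral_norm_conj_kernel r t : 0 < r -> r < 1 -> 0 <= t -> t <= 2 * pi ->
  (\int[mu]_(theta in J2pi) (`|conj_kernel r (t - theta)|)%:E =
   (4 * atanh r / (pi * r))%:E)%E.
Proof.
move=> r0 r1 t0 t1.
have cK : continuous (fun s => `|conj_kernel r (s - t)|).
  move=> s; apply: cvg_norm.
  exact: (continuous_shift_comp (continuous_conj_kernel (ltW r0) r1)).
have iK : mu.-integrable `[0, 2 * pi] (EFin \o (fun s => `|conj_kernel r (s - t)|)).
  by apply: continuous_compact_integrable; [exact: segment_compact|exact: continuous_subspaceT].
transitivity (\int[mu]_(s in J2pi) (EFin \o (fun s : R => `|conj_kernel r (s - t)|)%R) s)%E.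
  by apply: eq_integral => s _ /=; rewrite -opprB conj_kernelN normrN.
rewrite integral_itv_bndo_bndc; last first.
  by apply/measurable_EFinP; exact: measurable_continuous.
rewrite -(integral_norm_conj_kernel r0 r1 t0 t1) /Rintegral fineK//.
by apply: integrable_fin_num iK; exact: measurable_itv.
Qed.

(** The factor [M]^ p[arises in two portions:]M [^ (p - 1)] from Jensen's inequality with a weight
    of mass [M], and [M] from integrating the kernel over [theta] after the exchange of
    integrals. *)
Lemma integral_abs_w_r_circle_le p u v r : 1 <= p -> 0 < r -> r < 1 ->
  abs_continuous (u \o clip2pi) -> abs_continuous (v \o clip2pi) ->
  u 0 = u (2 * pi) -> v 0 = v (2 * pi) ->
  measurable_fun T2pi (derive1 u) -> measurable_fun T2pi (derive1 v) ->
  (\int[mu]_(t in T2pi) ((abs_Fdot u v t) `^ p)%:E < +oo)%E ->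
  (\int[mu]_(theta in J2pi) ((abs_w_r u v r theta) `^ p)%:E <=
   ((4 * atanh r / (pi * r)) `^ p)%:E *
   \int[mu]_(t in T2pi) ((abs_Fdot u v t) `^ p)%:E)%E.
Proof.
move=> p1 r0 r1 hu hv u02 v02 mdu mdv Ioo.
have p0 : 0 < p by exact: lt_le_trans ltr01 p1.
set M := 4 * atanh r / (pi * r).
have M0 : 0 < M.
  by apply: divr_gt0; apply: mulr_gt0; rewrite ?pi_gt0 ?atanh_gt0.
have mT : measurable T2pi by exact: measurable_itv.
have mJ : measurable J2pi by exact: measurable_itv.
have JT : J2pi `<=` T2pi.
  by move=> t /=; rewrite !in_itv/= => /andP[-> /ltW].
have f0 t : 0 <= abs_Fdot u v t by exact: cmod_ge0.
have mf : measurable_fun T2pi (abs_Fdot u v) by exact: measurable_cmod.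
have mfp : measurable_fun T2pi (fun t => abs_Fdot u v t `^ p).
  exact: (measurableT_comp (measurable_powR p) mf).
pose fp : RT -> R := (fun t => abs_Fdot u v t `^ p) \_ T2pi.
have fp0 t : 0 <= fp t by rewrite /fp patchE; case: ifP => // _; exact: powR_ge0.
have mfpT : measurable_fun setT fp by apply/(measurable_restrictT _ mT).
have ifp : mu.-integrable T2pi (EFin \o (fun t => abs_Fdot u v t `^ p)).
  apply/integrableP; split; first exact/measurable_EFinP.
  under eq_integral do rewrite /= ger0_norm ?powR_ge0//.
  exact: Ioo.
have cK := continuous_conj_kernel (ltW r0) r1.
(* Extension by zero to the whole plane, where Tonelli's theorem is applied. *)
pose Phi (x : RT * RT) : \bar R :=
  (\1_J2pi x.1 * (`|conj_kernel r (x.2 - x.1)| * fp x.2))%:E.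
have Phi0 x : (0 <= Phi x)%E by rewrite lee_fin !mulr_ge0.
have mPhi : measurable_fun setT Phi.
  apply/measurable_EFinP; apply: measurable_funM.
    apply: (@measurableT_comp _ _ _ _ _ _ (\1_J2pi : RT -> R)); last exact: measurable_fst.
    exact: measurable_indic.
  apply: measurable_funM; last exact: (measurableT_comp mfpT measurable_snd).
  apply: measurableT_comp => //.
  apply: (measurableT_comp (measurable_continuous cK)).
  by apply: measurable_funB; [exact: measurable_snd|exact: measurable_fst].
have mFPhi : measurable_fun setT (fubini_F mu Phi).
  exact: measurable_fun_fubini_tonelli_F.
have wle theta : J2pi theta -> (((abs_w_r u v r theta) `^ p)%:E <=
    (M `^ (p - 1))%:E * fubini_F mu Phi theta)%E.
  move=> thJ; have /= := JT _ thJ; rewrite in_itv/= => /andP[th0 th1].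
  have [iF wF] := abs_w_r_le theta r0 r1 hu hv u02 v02 mdu mdv.
  have cKs : continuous (fun t => `|conj_kernel r (t - theta)|).
    by move=> t; apply: cvg_norm; exact: (continuous_shift_comp cK).
  have iKb g : mu.-integrable T2pi (EFin \o g) ->
      mu.-integrable T2pi (EFin \o (fun t => `|conj_kernel r (t - theta)| * g t)).
    apply: (@integrable_mul_bounded _ _ _ _ (pi^-1 * ((1 - r) ^+ 2)^-1)) => //.
      exact: measurable_continuous.
    by move=> t; rewrite normr_id; exact: conj_kernel_le (ltW r0) r1.
  have ik : mu.-integrable T2pi (EFin \o (fun t => `|conj_kernel r (t - theta)|)).
    by apply: continuous_compact_integrable; [exact: segment_compact|exact: continuous_subspaceT].
  have IM := integral_norm_conj_kernel r0 r1 th0 th1.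
  have kpos : 0 < \int[mu]_(t in T2pi) `|conj_kernel r (t - theta)| by rewrite IM.
  have J := jensen_powR mT p1 (fun t => normr_ge0 (conj_kernel r (t - theta))) f0
    ik (iKb _ iF) (iKb _ ifp) kpos.
  apply: (@le_trans _ _ ((\int[mu]_(t in T2pi)
      (`|conj_kernel r (t - theta)| * abs_Fdot u v t)) `^ p)%:E).
    rewrite lee_fin; apply: ge0_ler_powR wF; rewrite ?nnegrE ?(ltW p0)//.
      exact: cmod_ge0.
    by apply: Rintegral_ge0 => t _; rewrite mulr_ge0.
  apply: (@le_trans _ _ (M `^ (p - 1) * \int[mu]_(t in T2pi)
      (`|conj_kernel r (t - theta)| * abs_Fdot u v t `^ p))%:E).
    by rewrite lee_fin; apply: le_trans J _; rewrite IM.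
  rewrite EFinM lee_wpmul2l ?lee_fin ?powR_ge0// /Rintegral fineK; last first.
    by apply: integrable_fin_num (iKb _ ifp).
  rewrite integral_mkcond le_eqVlt; apply/orP; left; apply/eqP.
  rewrite /fubini_F; apply: eq_integral => t _.
  rewrite /Phi /= indicE mem_set// mul1r /fp !patchE.
  by case: ifP => _; rewrite ?mulr0.
apply: (@le_trans _ _ ((M `^ (p - 1))%:E * \int[mu]_(theta in J2pi) fubini_F mu Phi theta)%E).
  rewrite -ge0_integralZl_EFin ?powR_ge0//; last 2 first.
  - by move=> theta _; apply: integral_ge0.
  - exact: measurable_funTS.
  apply: ge0_le_integral => //.
  - by move=> theta _; rewrite lee_fin powR_ge0.
  - apply/measurable_EFinP; apply: (measurableT_comp (measurable_powR p)).
    exact: measurable_abs_w_r_section.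
  - by apply: measurable_funeM; exact: measurable_funTS.
have -> : (M `^ p)%:E = ((M `^ (p - 1))%:E * M%:E)%E.
  rewrite -EFinM; congr EFin.
  have -> : M `^ p = M `^ ((p - 1) + 1) by rewrite subrK.
  rewrite powRD ?powRr1 ?(ltW M0)//.
  by apply/implyP => _; rewrite gt_eqF.
rewrite -muleA lee_wpmul2l ?lee_fin ?powR_ge0//.
apply: (@le_trans _ _ (\int[mu]_theta fubini_F mu Phi theta)%E).
  apply: ge0_subset_integral => //.
  by move=> theta _; apply: integral_ge0.
have := @fubini_tonelli _ _ RT RT R mu mu Phi mPhi Phi0.
rewrite /fubini_F => ->.
have -> : (\int[mu]_y \int[mu]_x Phi (x, y) = \int[mu]_y (M * fp y)%:E)%E.
  apply: eq_integral => t _; rewrite /Phi /=.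
  have [tT|tT] := boolP (t \in T2pi); last first.
    rewrite integral0_eq; last first.
      by move=> x _; rewrite /fp patchE (negbTE tT) !mulr0.
    by rewrite /fp patchE (negbTE tT) mulr0.
  move: (tT); rewrite inE/= in_itv/= => /andP[t0 t1].
  rewrite EFinM -(eintegral_norm_conj_kernel r0 r1 t0 t1) muleC.
  have mKt : measurable_fun J2pi (fun theta => (`|conj_kernel r (t - theta)|)%:E).
    apply/measurable_EFinP; apply: measurableT_comp => //.
    apply: (measurableT_comp (measurable_continuous cK)).
    exact: measurable_funB.
  rewrite -ge0_integralZl_EFin//.
  rewrite [RHS]integral_mkcond; apply: eq_integral => x _.
  rewrite patchE indicE; case: ifP => _; last by rewrite mul0r.
  by rewrite mul1r -EFinM mulrC.
under eq_integral do rewrite EFinM.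
rewrite ge0_integralZl_EFin//.
- rewrite lee_wpmul2l ?lee_fin ?(ltW M0)// [leRHS]integral_mkcond.
  rewrite le_eqVlt; apply/orP; left; apply/eqP; apply: eq_integral => t _.
  by rewrite /fp !patchE; case: ifP.
- by move=> t _; rewrite lee_fin.
- exact/measurable_EFinP.
- exact: ltW.
Qed.

Lemma bergman_pow_le p u v : 1 <= p ->
  abs_continuous (u \o clip2pi) -> abs_continuous (v \o clip2pi) ->
  u 0 = u (2 * pi) -> v 0 = v (2 * pi) ->
  measurable_fun T2pi (derive1 u) -> measurable_fun T2pi (derive1 v) ->
  (\int[mu]_(t in T2pi) ((abs_Fdot u v t) `^ p)%:E < +oo)%E ->
  (bergman_pow u v p <= 2%:E * Cp p * circle_pow u v p)%E.
Proof.
move=> p1 hu hv u02 v02 mdu mdv Ioo.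
set I := (\int[mu]_(t in T2pi) ((abs_Fdot u v t) `^ p)%:E)%E in Ioo.
have I0 : (0 <= I)%E by apply: integral_ge0 => t _; rewrite lee_fin powR_ge0.
have Ifin : I \is a fin_num by rewrite ge0_fin_numE.
have m01 : measurable (`]0, 1[%classic : set RT) by exact: measurable_itv.
have mJ : measurable J2pi by exact: measurable_itv.
pose g (z : RT * RT) : \bar R := ((abs_w_r u v z.1 z.2) `^ p * (z.1 / pi))%:E.
have mg : measurable_fun setT (g \_ D2).
  apply/(measurable_restrictT _ measurable_D2); apply/measurable_EFinP.
  apply: measurable_funM.
    by apply: (measurableT_comp (measurable_powR p)); exact: measurable_abs_w_r.
  by apply: measurable_funM => //; apply: measurable_funTS; exact: measurable_fst.
have g0 z : (0 <= (g \_ D2) z)%E.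
  rewrite patchE; case: ifPn => // /set_mem [] /=; rewrite in_itv/= => /andP[z0 _] _.
  by rewrite lee_fin mulr_ge0 ?powR_ge0// divr_ge0 ?pi_ge0// ltW.
pose N r : R := (4 * atanh r / (pi * r)) `^ p * r.
have N0 r : 0 < r -> 0 <= N r by move=> r0; rewrite mulr_ge0 ?powR_ge0 ?ltW.
have mN : measurable_fun (`]0, 1[%classic : set RT) (fun r => (N r)%:E).
  exact: measurable_Cp_integrand.
have Ipi0 : (0 <= I * pi^-1%:E)%E by rewrite mule_ge0// lee_fin invr_ge0 pi_ge0.
(* Here $2\cdot(2\pi)^{-1}=\pi^{-1}$ is the weight of $dA$, which accounts for the 2 in front of
   $C(p)$. *)
have -> : (2%:E * Cp p * circle_pow u v p = Cp p * (I * pi^-1%:E))%E.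
  rewrite /circle_pow -/I muleAC (muleC _ (Cp p)); congr (_ * _)%E.
  rewrite muleA -EFinM muleC; congr (_ * _%:E)%E.
  by have := @pi_neq0 R; move: (@pi R) => q pn0; field.
rewrite /bergman_pow integral_mkcond -/g (@fubini_tonelli1 _ _ RT RT R mu mu _ mg g0).
rewrite /Cp -ge0_integralZr//; last first.
  by move=> r /=; rewrite in_itv/= => /andP[r0 _]; rewrite lee_fin; exact: N0.
rewrite [leRHS]integral_mkcond; apply: ge0_le_integral => //.
- by move=> r _; apply: integral_ge0 => t _; exact: g0.
- exact: measurable_fun_fubini_tonelli_F.
- apply/(measurable_restrictT _ m01).
  by apply: emeasurable_funM.
move=> r _; rewrite [leRHS]patchE.
case: ifPn => [|r01]; last first.
  rewrite /fubini_F integral0_eq// => t _; rewrite patchE memNset//= => -[/= rI _].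
  by move/negP: r01; apply; rewrite inE.
rewrite inE/= => r01; have := r01; rewrite in_itv/= => /andP[r0 r1].
have rpi0 : 0 <= r / pi by rewrite divr_ge0 ?pi_ge0 ?ltW.
have -> : fubini_F mu (g \_ D2) r =
    (\int[mu]_(theta in J2pi) ((abs_w_r u v r theta) `^ p)%:E * (r / pi)%:E)%E.
  rewrite -ge0_integralZr//.
  - rewrite [RHS]integral_mkcond; apply: eq_integral => t _; rewrite !patchE.
    have -> : ((r, t) \in D2) = (t \in J2pi).
      apply/idP/idP; rewrite !inE; first by case.
      by move=> tJ; split.
    by [].
  - apply/measurable_EFinP; apply: (measurableT_comp (measurable_powR p)).
    exact: measurable_abs_w_r_section.
  - by move=> t _; rewrite lee_fin powR_ge0.
apply: (@le_trans _ _ (((4 * atanh r / (pi * r)) `^ p)%:E * I * (r / pi)%:E)%E).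
  rewrite lee_wpmul2r ?lee_fin//.
  exact: integral_abs_w_r_circle_le.
by rewrite !EFinM -!muleA lee_wpmul2l ?lee_fin ?powR_ge0// muleCA.
Qed.

End bergman.

Unset Implicit Arguments.

Theorem theorem1p1 (R : realType) (p : R) (u v : R -> R) :
  1 <= p ->
  abs_continuous_C 0 (2 * pi) u v ->
  u 0 = u (2 * pi) -> v 0 = v (2 * pi) ->
  measurable_fun `[0, 2 * pi] (derive1 u) ->
  measurable_fun `[0, 2 * pi] (derive1 v) ->
  (\int[@lebesgue_measure R]_(t in `[0%R, (2 * pi)%R]) ((abs_Fdot u v t) `^ p)%:E < +oo)%E ->
  [/\ (Cp p < +oo)%E,
      (bergman_pow u v p `^ p^-1 <= (2%:E * Cp p) `^ p^-1 * circle_pow u v p `^ p^-1)%E,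
      measurable_fun (`]0%R, 1%R[ `*` `[0%R, (2 * pi)%R[ : set (R * R)) (fun z : R * R => abs_w_r u v z.1 z.2)
    & (bergman_pow u v p < +oo)%E].
Proof.
move=> p1 huv u02 v02 mdu mdv Ioo.
have pi20 : 0 <= 2 * pi :> R by rewrite mulr_ge0// pi_ge0.
have hu := abs_continuous_clip pi20 huv.
have hv := abs_continuous_clip pi20 (abs_continuous_CC huv).
have Cpoo := Cp_lty p1.
have le := bergman_pow_le p1 hu hv u02 v02 mdu mdv Ioo.
have Cp0 : (0 <= Cp p)%E.
  apply: integral_ge0 => r /=; rewrite in_itv/= => /andP[r0 _].
  by rewrite lee_fin mulr_ge0 ?powR_ge0 ?ltW.
have c0 : (0 <= circle_pow u v p)%E.
  rewrite /circle_pow mule_ge0 ?lee_fin ?invr_ge0//.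
  by apply: integral_ge0 => t _; rewrite lee_fin powR_ge0.
have coo : (circle_pow u v p < +oo)%E.
  by rewrite /circle_pow lte_mul_pinfty ?lee_fin ?invr_ge0.
have b0 : (0 <= bergman_pow u v p)%E.
  apply: integral_ge0 => z [] /=; rewrite in_itv/= => /andP[z0 _] _.
  by rewrite lee_fin mulr_ge0 ?powR_ge0// divr_ge0 ?pi_ge0// ltW.
have c20 : (0 <= 2%:E * Cp p)%E by rewrite mule_ge0.
split => //.
(* The [p]-th root is multiplicative and monotone on nonnegative extended reals. *)
- rewrite -poweRM//; apply: gt0_ler_poweR le.
  + by rewrite invr_ge0 (le_trans ler01).
  + by rewrite in_itv/= b0 leey.
  + by rewrite in_itv/= mule_ge0// leey.
- exact: measurable_abs_w_r.
- apply: le_lt_trans le _; rewrite lte_mul_pinfty ?ge0_fin_numE//.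
  by rewrite lte_mul_pinfty.
Qed.
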